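(* The equational theory of the time warp algebra $\mathbf{W}$ is decidable: there is an algorithm that, given any two terms $s,t$, decides whether $\mathbf{W}\models s\approx t$.
   Context: Let $\omega^+=\omega\cup\{\omega\}$ with its natural order. A time warp is a map $f\colon\omega^+\to\omega^+$ preserving arbitrary joins (equivalently, $f$ is order-preserving, $f(0)=0$ and $f(\omega)=\bigvee\{f(n)\mid n\in\omega\}$). Let $W$ be the set of time warps, ordered pointwise. Let $p\in W$ be the predecessor map $p(m)=\bigvee\{n\in\omega\mid n<m\}$ (so $p(0)=0$, $p(\omega)=\omega$, $p(m)=m-1$ otherwise), and for $f,g\in W$ let $f\backslash g$ be the largest time warp $h$ with $f\circ h\le g$. The time warp algebra is $\mathbf{W}=\langle W,\wedge,\vee,\circ,{}^\star,\mathrm{id}\rangle$ with pointwise meet and join, composition, involution $f^\star:=f\backslash p$, and identity $\mathrm{id}$. Terms are built from a countably infinite set of variables using binary $\wedge,\vee,\cdot$, unary ${}'$ and the constant $1$, interpreted in $\mathbf{W}$ as $\wedge,\vee,\circ,{}^\star,\mathrm{id}$; $\mathbf{W}\models s\approx t$ means that $s$ and $t$ take equal values under every assignment of time warps to variables. *)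

(* Defs.v *)
From Stdlib Require Import List Arith ClassicalEpsilon.
Import ListNotations.

Inductive omp : Type := Fin (n : nat) | Om.

Definition leo (x y : omp) : Prop :=
  match x, y with
  | Fin a, Fin b => a <= b
  | _, Om => True
  | Om, Fin _ => False
  end.

Definition is_lub (S : omp -> Prop) (x : omp) : Prop :=
  (forall y, S y -> leo y x) /\ (forall u, (forall y, S y -> leo y u) -> leo x u).

Definition time_warp (f : omp -> omp) : Prop :=
  forall (S : omp -> Prop) (x : omp),
    is_lub S x -> is_lub (fun z => exists y, S y /\ z = f y) (f x).

Definition minO (x y : omp) : omp :=
  match x, y with
  | Fin a, Fin b => Fin (Nat.min a b)
  | Om, y => y
  | x, Om => x
  end.
Definition maxO (x y : omp) : omp :=
  match x, y with
  | Fin a, Fin b => Fin (Nat.max a b)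
  | Om, _ => Om
  | _, Om => Om
  end.

Definition pred_tw (x : omp) : omp :=
  match x with
  | Fin 0 => Fin 0
  | Fin (S n) => Fin n
  | Om => Om
  end.

Definition is_resid (f g h : omp -> omp) : Prop :=
  time_warp h /\ (forall x, leo (f (h x)) (g x)) /\
  (forall h', time_warp h' -> (forall x, leo (f (h' x)) (g x)) ->
              forall x, leo (h' x) (h x)).

Definition resid (f g : omp -> omp) : omp -> omp :=
  epsilon (inhabits (fun x : omp => x)) (is_resid f g).

Definition star (f : omp -> omp) : omp -> omp := resid f pred_tw.

Inductive term : Type :=
| TVar (n : nat)
| TMeet (s t : term)
| TJoin (s t : term)
| TMul (s t : term)
| TStar (s : term)
| TOne.

Fixpoint evalT (a : nat -> omp -> omp) (s : term) : omp -> omp :=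
  match s with
  | TVar n => a n
  | TMeet s t => fun x => minO (evalT a s x) (evalT a t x)
  | TJoin s t => fun x => maxO (evalT a s x) (evalT a t x)
  | TMul s t => fun x => evalT a s (evalT a t x)
  | TStar s => star (evalT a s)
  | TOne => fun x => x
  end.

Definition W_models (s t : term) : Prop :=
  forall a : nat -> omp -> omp, (forall n, time_warp (a n)) ->
  forall x, evalT a s x = evalT a t x.

(** * Goedel numbering of terms (Cantor pairing) *)
Definition cpair (a b : nat) : nat := (a + b) * (a + b + 1) / 2 + b.

Fixpoint enc (s : term) : nat :=
  match s with
  | TVar n => cpair 0 n
  | TMeet s t => cpair 1 (cpair (enc s) (enc t))
  | TJoin s t => cpair 2 (cpair (enc s) (enc t))
  | TMul s t => cpair 3 (cpair (enc s) (enc t))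
  | TStar s => cpair 4 (enc s)
  | TOne => cpair 5 0
  end.

Inductive prf : Type :=
| PZero
| PSucc
| PProj (i : nat)
| PComp (f : prf) (gs : list prf)
| PRec (f g : prf)
| PMu (f : prf).

Inductive evalp : prf -> list nat -> nat -> Prop :=
| ev_zero v : evalp PZero v 0
| ev_succ x v : evalp PSucc (x :: v) (S x)
| ev_proj i v : i < length v -> evalp (PProj i) v (nth i v 0)
| ev_comp f gs v ys y : evalps gs v ys -> evalp f ys y -> evalp (PComp f gs) v y
| ev_rec0 f g v y : evalp f v y -> evalp (PRec f g) (0 :: v) y
| ev_recS f g n v r y :
    evalp (PRec f g) (n :: v) r -> evalp g (n :: r :: v) y ->
    evalp (PRec f g) (S n :: v) y
| ev_mu f v n :
    evalp f (n :: v) 0 -> (forall m, m < n -> exists k, evalp f (m :: v) (S k)) ->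
    evalp (PMu f) v n
with evalps : list prf -> list nat -> list nat -> Prop :=
| evs_nil v : evalps nil v nil
| evs_cons g gs v y ys : evalp g v y -> evalps gs v ys -> evalps (g :: gs) v (y :: ys).

(* Main.v *)
Require Import Defs.
From Stdlib Require Import List Arith Lia Classical ClassicalEpsilon Cantor
  FunctionalExtensionality PropExtensionality.
Import ListNotations.

(* If an equation fails under an assignment at some point, the failure is witnessed by
   finitely many values of the subterms: for f' at a point x, with y = f'(x) finite and
   x > 0, it suffices to record f(y) < x <= f(y + 1). The one infinitary fact needed is
   whether a subterm has finite values at all finite arguments, which decides f'(omega)
   = omega, and this fact is also determined compositionally. Only the order and the
   successor relation between the recorded numbers matter, so replacing each number by
   its rank among them bounds the whole table in terms of the codes of the two terms.
   Conversely, a table satisfying the local conditions comes from time warps. Hence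
   failure of an equation is a bounded arithmetical formula in the codes. *)

(** * Bounded arithmetical formulas are decided by recursive functions *)

(** Finiteness at finite arguments is compositional for the following reasons. For meet it is a
    disjunction, for join a conjunction, and for f' it says that f(omega) = omega. For a composite
    of f after g there are two cases: if g is finite at finite arguments and g(omega) = omega, the
    values of g are cofinal in the finite numbers and f alone decides; otherwise g reaches g(omega)
    at a finite argument, and the question is whether f(g(omega)) is finite.

    In the converse direction only the variables have to be realised by time warps. The delicate
    point is omega: f(omega) must be the supremum of values at finite arguments, without disturbing
    the recorded ones. Since K stands for omega, the finite arguments from K on carry no record and
    are free for this growth.

    A whole table is the set of binary digits of one number, so that the search for a table is a
    bounded quantifier too. Formulas are compiled by structural recursion; excluded middle enters
    only the correctness proofs, never the code. *)

Lemma ev_proj_eq i v y : i < length v -> nth i v 0 = y -> evalp (PProj i) v y.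
Proof. intros Hi <-; now constructor. Qed.

Lemma ev_comp1 f g v x y : evalp g v x -> evalp f [x] y -> evalp (PComp f [g]) v y.
Proof. intros; econstructor; [repeat econstructor|]; eassumption. Qed.

Lemma ev_comp2 f g h v x y z :
  evalp g v x -> evalp h v y -> evalp f [x; y] z -> evalp (PComp f [g; h]) v z.
Proof. intros; econstructor; [repeat econstructor|]; eassumption. Qed.

Lemma ev_rec (F : nat -> nat) f g v :
  evalp f v (F 0) -> (forall k, evalp g (k :: F k :: v) (F (S k))) ->
  forall n, evalp (PRec f g) (n :: v) (F n).
Proof. intros H0 HS; induction n; econstructor; eauto. Qed.

Ltac proj := apply ev_proj_eq; cbn; [lia | reflexivity].

Fixpoint pconst (n : nat) : prf :=
  match n with 0 => PZero | S n => PComp PSucc [pconst n] end.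

Lemma ev_const n v : evalp (pconst n) v n.
Proof.
  induction n; cbn; [constructor|]. eapply ev_comp1; [eassumption | constructor].
Qed.

Definition padd : prf := PRec (PProj 0) (PComp PSucc [PProj 1]).

Lemma ev_add x y : evalp padd [x; y] (x + y).
Proof.
  apply (ev_rec (fun x => x + y)); [proj|]. intros k.
  eapply ev_comp1; [proj | constructor].
Qed.

Definition ppred : prf := PRec PZero (PProj 0).

Lemma ev_pred x : evalp ppred [x] (pred x).
Proof. apply (ev_rec pred); [constructor|]. intros k; proj. Qed.

(** [PRec] recurs on the first argument; the swap makes it iterate the predecessor [y] times on
    [x]. *)
Definition psub : prf :=
  PComp (PRec (PProj 0) (PComp ppred [PProj 1])) [PProj 1; PProj 0].

Lemma ev_sub x y : evalp psub [x; y] (x - y).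
Proof.
  eapply ev_comp2; [proj|proj|].
  apply (ev_rec (fun y => x - y)); [rewrite Nat.sub_0_r; proj|]. intros k.
  eapply ev_comp1; [proj|]. replace (x - S k) with (pred (x - k)) by lia.
  apply ev_pred.
Qed.

Definition piszero : prf := PRec (pconst 1) PZero.

Lemma ev_iszero x : evalp piszero [x] (match x with 0 => 1 | _ => 0 end).
Proof.
  apply (ev_rec (fun x => match x with 0 => 1 | _ => 0 end));
    [apply ev_const | constructor].
Qed.

Definition pparity : prf := PRec PZero (PComp piszero [PProj 1]).

Lemma ev_parity x : evalp pparity [x] (Nat.b2n (Nat.odd x)).
Proof.
  apply (ev_rec (fun x => Nat.b2n (Nat.odd x))); [constructor|]. intros k.
  eapply ev_comp1; [proj|].
  rewrite Nat.odd_succ, <- Nat.negb_odd.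
  destruct (Nat.odd k); apply ev_iszero.
Qed.

Definition pdiv2 : prf :=
  PRec PZero (PComp padd [PProj 1; PComp pparity [PProj 0]]).

Lemma ev_div2 x : evalp pdiv2 [x] (Nat.div2 x).
Proof.
  apply (ev_rec Nat.div2); [constructor|]. intros k.
  eapply ev_comp2; [proj | eapply ev_comp1; [proj | apply ev_parity] |].
  replace (Nat.div2 (S k)) with (Nat.div2 k + Nat.b2n (Nat.odd k)).
  - apply ev_add.
  - pose proof (Nat.div2_odd k); pose proof (Nat.div2_odd (S k)) as H'.
    rewrite Nat.odd_succ, <- Nat.negb_odd in H'.
    destruct (Nat.odd k); cbn [negb Nat.b2n] in *; lia.
Qed.

(** Bit [i] of [t] is the parity of [t] after [i] halvings. *)
Definition pbit : prf :=
  PComp pparity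
    [PComp (PRec (PProj 0) (PComp pdiv2 [PProj 1])) [PProj 1; PProj 0]].

Lemma ev_bit t i : evalp pbit [t; i] (Nat.b2n (Nat.testbit t i)).
Proof.
  eapply ev_comp1.
  - eapply ev_comp2; [proj|proj|].
    apply (ev_rec (fun i => Nat.shiftr t i)); [proj|]. intros k.
    eapply ev_comp1; [proj | apply ev_div2].
  - rewrite Nat.testbit_odd. apply ev_parity.
Qed.

Definition ppow2 : prf := PRec (pconst 1) (PComp padd [PProj 1; PProj 1]).

Lemma ev_pow2 x : evalp ppow2 [x] (2 ^ x).
Proof.
  apply (ev_rec (fun x => 2 ^ x)); [apply ev_const|]. intros k.
  eapply ev_comp2; [proj|proj|].
  replace (2 ^ S k) with (2 ^ k + 2 ^ k) by (cbn; lia). apply ev_add.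
Qed.

Lemma cpair_to_nat a b : cpair a b = to_nat (a, b).
Proof.
  unfold cpair. pose proof (to_nat_spec a b) as H.
  assert ((a + b) * (a + b + 1) / 2 = to_nat (a, b) - b) as ->; [|lia].
  symmetry; apply Nat.div_unique_exact; nia.
Qed.

Lemma cpair_inj a b a' b' : cpair a b = cpair a' b' -> a = a' /\ b = b'.
Proof.
  rewrite !cpair_to_nat; intros H%to_nat_inj. now injection H.
Qed.

Lemma cpair_double a b : cpair a b * 2 = b * 2 + (b + a) * S (b + a).
Proof. rewrite cpair_to_nat; apply to_nat_spec. Qed.

Lemma cpair_add_le a b : a + b <= cpair a b.
Proof. pose proof (cpair_double a b); nia. Qed.

Lemma cpair_mono a b a' b' : a <= a' -> b <= b' -> cpair a b <= cpair a' b'.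
Proof.
  intros; pose proof (cpair_double a b); pose proof (cpair_double a' b'). nia.
Qed.

(** Triangular numbers: the step sees just the counter and the previous value, so [padd] adds the
    two. *)
Definition ptri : prf := PRec PZero (PComp PSucc [padd]).

Definition pcpair : prf := PComp padd [PProj 1; PComp ptri [PComp padd [PProj 1; PProj 0]]].

Lemma ev_cpair a b : evalp pcpair [a; b] (cpair a b).
Proof.
  rewrite cpair_to_nat; unfold to_nat.
  eapply ev_comp2; [proj | | apply ev_add].
  eapply ev_comp1; [eapply ev_comp2; [proj | proj | apply ev_add]|].
  apply (ev_rec (nat_rec _ 0 (fun i m => S i + m))); [constructor|]. intros k.
  eapply ev_comp1; [apply ev_add | constructor].
Qed.

(* Variables are de Bruijn levels: a quantifier appends its variable at the end
   of the environment, so that the names of the outer variables do not change. *)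
Inductive ex : Type :=
| V (i : nat)
| C (n : nat)
| Add (e1 e2 : ex)
| Sub (e1 e2 : ex)
| Pair (e1 e2 : ex)
| Pow2 (e : ex).

Inductive fm : Type :=
| Le (e1 e2 : ex)
| Eq (e1 e2 : ex)
| Bit (t i : ex)
| Not (f : fm)
| And (f g : fm)
| Or (f g : fm)
| Imp (f g : fm)
| Exi (b : ex) (f : fm)
| All (b : ex) (f : fm).

Fixpoint den (v : list nat) (e : ex) : nat :=
  match e with
  | V i => nth i v 0
  | C n => n
  | Add e1 e2 => den v e1 + den v e2
  | Sub e1 e2 => den v e1 - den v e2
  | Pair e1 e2 => cpair (den v e1) (den v e2)
  | Pow2 e => 2 ^ den v e
  end.

Fixpoint sat (v : list nat) (f : fm) : Prop :=
  match f with
  | Le e1 e2 => den v e1 <= den v e2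
  | Eq e1 e2 => den v e1 = den v e2
  | Bit t i => Nat.testbit (den v t) (den v i) = true
  | Not f => ~ sat v f
  | And f g => sat v f /\ sat v g
  | Or f g => sat v f \/ sat v g
  | Imp f g => sat v f -> sat v g
  | Exi b f => exists k, k <= den v b /\ sat (v ++ [k]) f
  | All b f => forall k, k <= den v b -> sat (v ++ [k]) f
  end.

(** * Compilation of bounded formulas into recursive functions *)

Fixpoint code_ex (L : nat) (e : ex) : prf :=
  match e with
  | V i => if i <? L then PProj i else PZero
  | C n => pconst n
  | Add e1 e2 => PComp padd [code_ex L e1; code_ex L e2]
  | Sub e1 e2 => PComp psub [code_ex L e1; code_ex L e2]
  | Pair e1 e2 => PComp pcpair [code_ex L e1; code_ex L e2]
  | Pow2 e => PComp ppow2 [code_ex L e]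
  end.

Definition pnot (c : prf) : prf := PComp piszero [c].
(** The sum of two truth values can be 2; the double negation brings it back to 0 or 1. *)
Definition por (c d : prf) : prf := pnot (pnot (PComp padd [c; d])).
Definition pand (c d : prf) : prf := pnot (por (pnot c) (pnot d)).
Definition ple (c d : prf) : prf := pnot (PComp psub [c; d]).

(** Bounded search by recursion. The step finds the counter and the verdict on smaller candidates in
    front of the environment, which thus starts at position 2; the counter is moved to the end,
    where levels expect it. Recursion up to [m] tests only candidates below [m], hence the successor
    of the bound. *)
Definition pexi (L : nat) (b c : prf) : prf :=
  PComp (PRec PZero (por (PProj 1) (PComp c (map PProj (seq 2 L) ++ [PProj 0]))))
        (PComp PSucc [b] :: map PProj (seq 0 L)).

Fixpoint code_fm (L : nat) (f : fm) : prf :=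
  match f with
  | Le e1 e2 => ple (code_ex L e1) (code_ex L e2)
  | Eq e1 e2 => pand (ple (code_ex L e1) (code_ex L e2)) (ple (code_ex L e2) (code_ex L e1))
  | Bit t i => PComp pbit [code_ex L t; code_ex L i]
  | Not f => pnot (code_fm L f)
  | And f g => pand (code_fm L f) (code_fm L g)
  | Or f g => por (code_fm L f) (code_fm L g)
  | Imp f g => por (pnot (code_fm L f)) (code_fm L g)
  | Exi b f => pexi L (code_ex L b) (code_fm (S L) f)
  | All b f => pnot (pexi L (code_ex L b) (pnot (code_fm (S L) f)))
  end.

(** The code is fixed before it is known which case holds, so the truth of [P] may be settled by
    excluded middle while [c] remains an algorithm. *)
Definition decides (c : prf) (v : list nat) (P : Prop) : Prop :=
  (P -> evalp c v 1) /\ (~ P -> evalp c v 0).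

Lemma decides_iff c v P Q : (P <-> Q) -> decides c v P -> decides c v Q.
Proof. unfold decides; tauto. Qed.

Lemma decides_not c v P : decides c v P -> decides (pnot c) v (~ P).
Proof.
  intros [H1 H0]; split; intros H.
  - eapply ev_comp1; [eauto | apply (ev_iszero 0)].
  - eapply ev_comp1; [apply H1; tauto | apply (ev_iszero 1)].
Qed.

Lemma decides_or c d v P Q :
  decides c v P -> decides d v Q -> decides (por c d) v (P \/ Q).
Proof.
  intros Hc Hd.
  assert (exists n, evalp (PComp padd [c; d]) v n /\ (n = 0 <-> ~ (P \/ Q))) as (n & Hn & E).
  { destruct Hc as [Hc1 Hc0], Hd as [Hd1 Hd0].
    destruct (classic P) as [p|p], (classic Q) as [q|q];
      (eexists; split; [eapply ev_comp2; [eauto|eauto|apply ev_add] | cbn; intuition lia]). }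
  split; intros H; eapply ev_comp1;
    try (eapply ev_comp1; [eassumption | apply ev_iszero]).
  - destruct n; [tauto|]. apply (ev_iszero 0).
  - replace n with 0 by (symmetry; tauto). apply (ev_iszero 1).
Qed.

Lemma decides_and c d v P Q :
  decides c v P -> decides d v Q -> decides (pand c d) v (P /\ Q).
Proof.
  intros Hc Hd. eapply decides_iff; [|apply decides_not, decides_or; apply decides_not; eassumption].
  tauto.
Qed.

Lemma decides_le c d v m n :
  evalp c v m -> evalp d v n -> decides (ple c d) v (m <= n).
Proof.
  intros; split; intros Hle;
    (eapply ev_comp1; [eapply ev_comp2; [eassumption|eassumption|apply ev_sub]|]).
  - replace (m - n) with 0 by lia. apply (ev_iszero 0).
  - replace (m - n) with (S (pred (m - n))) by lia. apply (ev_iszero (S _)).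
Qed.

Lemma ev_projs v w : evalps (map PProj (seq (length w) (length v))) (w ++ v) v.
Proof.
  revert w; induction v as [|x v IH]; intros w; [constructor|].
  cbn [length seq map]; constructor.
  - apply ev_proj_eq; [rewrite length_app; cbn; lia | apply nth_middle].
  - specialize (IH (w ++ [x])).
    rewrite length_app, <- app_assoc in IH; cbn in IH.
    now rewrite Nat.add_comm in IH.
Qed.

Lemma evalps_app gs hs v ys zs :
  evalps gs v ys -> evalps hs v zs -> evalps (gs ++ hs) v (ys ++ zs).
Proof. induction 1; cbn; [auto | constructor; auto]. Qed.

Lemma decides_exi L b c v n (P : nat -> Prop) :
  length v = L -> evalp b v n ->
  (forall k, decides c (v ++ [k]) (P k)) ->
  decides (pexi L b c) v (exists k, k <= n /\ P k).
Proof.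
  intros HL Hb Hc.
  set (step := por (PProj 1) (PComp c (map PProj (seq 2 L) ++ [PProj 0]))).
  assert (Hrec : forall m, decides (PRec PZero step) (m :: v) (exists k, k < m /\ P k)).
  { induction m as [|m IH].
    - split; [intros (k & Hk & _); lia|]. intros _; repeat constructor.
    - assert (exists r, evalp (PRec PZero step) (m :: v) r /\
                decides (PProj 1) (m :: r :: v) (exists k, k < m /\ P k)) as (r & Hr & Hd).
      { destruct IH as [H1 H0].
        destruct (classic (exists k, k < m /\ P k)) as [H|H];
          [exists 1 | exists 0]; (split; [auto|]);
          split; intros; try contradiction; proj. }
      assert (Hd' : decides (PComp c (map PProj (seq 2 L) ++ [PProj 0])) (m :: r :: v) (P m)).
      { assert (evalps (map PProj (seq 2 L) ++ [PProj 0]) (m :: r :: v) (v ++ [m])).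
        { apply evalps_app; [rewrite <- HL; apply (ev_projs v [m; r])|].
          constructor; [proj | constructor]. }
        destruct (Hc m); split; intros; econstructor; eauto. }
      pose proof (decides_or _ _ _ _ _ Hd Hd') as [H1 H0].
      assert (E : (exists k, k < S m /\ P k) <-> (exists k, k < m /\ P k) \/ P m).
      { split.
        - intros (k & Hk & HP). destruct (Nat.eq_dec k m) as [->|]; [auto|].
          left; exists k; split; [lia|auto].
        - intros [(k & Hk & HP)|HP]; [exists k | exists m]; auto with arith. }
      split; intros H; econstructor; eauto; [apply H1 | apply H0]; tauto. }
  assert (Hargs : evalps (PComp PSucc [b] :: map PProj (seq 0 L)) v (S n :: v)).
  { constructor; [eapply ev_comp1; [eassumption|constructor]|].
    rewrite <- HL; apply (ev_projs v []). }
  assert (E : (exists k, k <= n /\ P k) <-> (exists k, k < S n /\ P k)).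
  { split; intros (k & Hk & HP); exists k; split; auto; lia. }
  destruct (Hrec (S n)) as [H1 H0].
  split; intros H; (econstructor; [eassumption|]); [apply H1 | apply H0]; tauto.
Qed.

Lemma code_ex_correct v e : evalp (code_ex (length v) e) v (den v e).
Proof.
  induction e; cbn [code_ex den].
  - destruct (Nat.ltb_spec i (length v)); [now constructor|].
    (* A variable outside the environment denotes the default 0 of [nth]; [PProj] would have no
       value there. *)
    rewrite nth_overflow by assumption. constructor.
  - apply ev_const.
  - eapply ev_comp2; eauto using ev_add.
  - eapply ev_comp2; eauto using ev_sub.
  - eapply ev_comp2; eauto using ev_cpair.
  - eapply ev_comp1; eauto using ev_pow2.
Qed.

Lemma code_fm_correct f v : decides (code_fm (length v) f) v (sat v f).
Proof.
  revert v; induction f; intros v; cbn [code_fm sat].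
  - apply decides_le; apply code_ex_correct.
  - apply decides_iff with (den v e1 <= den v e2 /\ den v e2 <= den v e1); [lia|].
    apply decides_and; apply decides_le; apply code_ex_correct.
  - assert (H := ev_bit (den v t) (den v i)).
    split; intros E; (eapply ev_comp2; [apply code_ex_correct|apply code_ex_correct|]).
    + now rewrite E in H.
    + now rewrite (Bool.not_true_is_false _ E) in H.
  - now apply decides_not.
  - now apply decides_and.
  - now apply decides_or.
  - eapply decides_iff; [|apply decides_or; [apply decides_not|]; auto]. tauto.
  - apply decides_exi; [reflexivity|apply code_ex_correct|].
    intros k. specialize (IHf (v ++ [k])).
    rewrite length_app, Nat.add_comm in IHf. exact IHf.
  - eapply decides_iff; [|apply decides_not, decides_exi with (P := fun k => ~ sat (v ++ [k]) f);
      [reflexivity|apply code_ex_correct|]].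
    + split; [|intros H (k & Hk & Hn); auto].
      intros H k Hk. apply NNPP; intros Hn. eauto.
    + intros k. apply decides_not. specialize (IHf (v ++ [k])).
      rewrite length_app, Nat.add_comm in IHf. exact IHf.
Qed.

(** * Time warps and the involution *)

Definition lto (x y : omp) : Prop := ~ leo y x.

Ltac omp := unfold lto in *; cbn in *; try tauto; try congruence; try lia.

Lemma leo_refl x : leo x x.
Proof. destruct x; cbn; auto. Qed.

Lemma leo_trans x y z : leo x y -> leo y z -> leo x z.
Proof. destruct x, y, z; omp. Qed.

Lemma leo_antisym x y : leo x y -> leo y x -> x = y.
Proof. destruct x, y; omp. intros; f_equal; lia. Qed.

Lemma leo_total x y : leo x y \/ leo y x.
Proof. destruct x, y; omp. Qed.

Lemma leo_lto_trans x y z : leo x y -> lto y z -> lto x z.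
Proof. destruct x, y, z; omp. Qed.

Lemma lub_exists (S : omp -> Prop) : exists x, is_lub S x.
Proof.
  destruct (classic (exists n, forall y, S y -> leo y (Fin n))) as [[n Hn]|H].
  - induction n as [|n IH].
    + exists (Fin 0); split; auto. intros [|]; omp.
    + destruct (classic (forall y, S y -> leo y (Fin n))) as [|Hn']; [auto|].
      exists (Fin (Datatypes.S n)); split; auto. intros u Hu.
      apply not_all_ex_not in Hn' as [y Hy]. apply imply_to_and in Hy as [Sy Hy].
      specialize (Hu y Sy). specialize (Hn y Sy). destruct y, u; omp.
  - exists Om; split; [intros []; omp|].
    intros [n|] Hu; [|omp]. destruct H; eauto.
Qed.

Lemma time_warp_mono f x y : time_warp f -> leo x y -> leo (f x) (f y).
Proof.
  intros Hf Hxy.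
  destruct (Hf (fun z => z = x \/ z = y) y) as [H _].
  - split; [intros z [->| ->]; auto using leo_refl | intros u Hu; auto].
  - apply H; eauto.
Qed.

Lemma time_warp_zero f : time_warp f -> f (Fin 0) = Fin 0.
Proof.
  intros Hf. destruct (Hf (fun _ => False) (Fin 0)) as [_ H].
  - split; [tauto | intros [|]; omp].
  - assert (leo (f (Fin 0)) (Fin 0)) by (apply H; intros z (y & [] & _)).
    destruct (f (Fin 0)) as [[|n]|]; omp.
Qed.

Lemma time_warp_cont f u :
  time_warp f -> (forall n, leo (f (Fin n)) u) -> leo (f Om) u.
Proof.
  intros Hf Hu. destruct (Hf (fun z => exists n, z = Fin n) Om) as [_ H].
  - split; [intros y [n ->]; exact I|]. intros [m|] Hm; [|omp].
    specialize (Hm (Fin (S m)) (ex_intro _ _ eq_refl)). omp.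
  - apply H. intros z (y & [n ->] & ->). apply Hu.
Qed.

(** A positive finite supremum belongs to its set, so monotonicity suffices there. A set with
    supremum omega is cofinal in the finite numbers, and continuity bounds the value at omega by
    theirs. *)
Lemma time_warp_intro f :
  (forall x y, leo x y -> leo (f x) (f y)) -> f (Fin 0) = Fin 0 ->
  (forall u, (forall n, leo (f (Fin n)) u) -> leo (f Om) u) -> time_warp f.
Proof.
  intros mono zero cont S x [Hub Hl]; split.
  - intros z (y & Sy & ->). auto.
  - intros u Hu. destruct x as [[|n]|].
    + rewrite zero. destruct u; omp.
    + apply Hu. exists (Fin (Datatypes.S n)); split; [|reflexivity].
      apply NNPP; intros HS. specialize (Hl (Fin n)). cbn in Hl.
      enough (Datatypes.S n <= n) by lia. apply Hl. intros y Sy.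
      specialize (Hub y Sy). destruct y as [m|]; [|omp]. cbn in *.
      destruct (Nat.eq_dec m (Datatypes.S n)) as [->|]; [contradiction|lia].
    + apply cont. intros n.
      assert (exists y, S y /\ leo (Fin n) y) as (y & Sy & Hy).
      { apply NNPP; intros HS. apply (Hl (Fin n)). intros y Sy.
        destruct (leo_total y (Fin n)); [auto|]. destruct HS; eauto. }
      eapply leo_trans; [apply mono; eassumption|]. apply Hu; eauto.
Qed.

(** The pointwise suprema form a time warp [h]. Since [f] preserves them, and a value below [x] is
    at most the predecessor of [x], [h] satisfies the defining inequality of the residual. Residuals
    are unique by antisymmetry, so the choice made in [resid] is [h]. *)
Lemma star_lub f x : time_warp f -> is_lub (fun m => lto (f m) x) (star f x).
Proof.
  intros Hf.
  assert (exists h, forall x, is_lub (fun m => lto (f m) x) (h x)) as [h Hh].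
  { exists (fun x => epsilon (inhabits Om) (is_lub (fun m => lto (f m) x))).
    intros y. apply epsilon_spec, lub_exists. }
  assert (Hhtw : time_warp h).
  { apply time_warp_intro.
    - intros y z Hyz. apply (Hh y). intros m Hm. apply (Hh z).
      destruct (f m), y, z; omp.
    - apply leo_antisym; [|destruct (h _); omp].
      apply (Hh (Fin 0)). intros m Hm. destruct (f m); omp.
    - intros u Hu. apply (Hh Om). intros m Hm.
      destruct (f m) as [k|] eqn:E; [|omp].
      eapply leo_trans; [|apply (Hu (S k))]. apply (Hh (Fin (S k))).
      rewrite E; omp. }
  assert (Hres : is_resid f pred_tw h).
  { split; [exact Hhtw|split].
    - intros y. apply (Hf _ _ (Hh y)). intros z (m & Hm & ->).
      destruct (f m), y as [[|]|]; omp.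
    - intros h' Hh' Hle.
      assert (Hfin : forall n, leo (h' (Fin n)) (h (Fin n))).
      { intros [|n].
        - rewrite (time_warp_zero h') by assumption. destruct (h _); omp.
        - apply (Hh (Fin (S n))). specialize (Hle (Fin (S n))).
          destruct (f (h' (Fin (S n)))); omp. }
      (* At omega the inequality only bounds by omega and says nothing; the finite arguments and
         continuity of [h'] settle this case. *)
      intros [n|]; [apply Hfin|]. apply time_warp_cont; [assumption|]. intros n.
      eapply leo_trans; [apply Hfin|]. now apply time_warp_mono. }
  assert (Hst : is_resid f pred_tw (star f)).
  { unfold star, resid. apply epsilon_spec. eauto. }
  replace (star f x) with (h x); [apply Hh|].
  apply leo_antisym; [apply Hst | apply Hres]; first [apply Hres | apply Hst].
Qed.

Lemma time_warp_star f : time_warp f -> time_warp (star f).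
Proof.
  intros Hf. apply time_warp_intro.
  - intros x y Hxy. apply (star_lub f x Hf). intros m Hm.
    apply (star_lub f y Hf). destruct (f m), x, y; omp.
  - apply leo_antisym; [|destruct (star f _); omp].
    apply (star_lub f (Fin 0) Hf). intros m Hm. destruct (f m); omp.
  - intros u Hu. apply (star_lub f Om Hf). intros m Hm.
    destruct (f m) as [k|] eqn:E; [|omp].
    eapply leo_trans; [|apply (Hu (S k))]. apply (star_lub f _ Hf).
    rewrite E; omp.
Qed.

(** A finite supremum of a nonempty set is attained, so [m] is the last argument with value below
    [x]. At x = 0 the set is empty: the supremum is 0 although 0 is not in the set. *)
Lemma star_eq_fin f x m :
  time_warp f -> x <> Fin 0 ->
  star f x = Fin m <-> lto (f (Fin m)) x /\ leo x (f (Fin (S m))).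
Proof.
  intros Hf Hx. destruct (star_lub f x Hf) as [Hub Hl]. split.
  - intros E. rewrite E in *. split.
    + assert (exists y, lto (f y) x /\ leo (Fin m) y) as (y & Hy & Hmy).
      { destruct m as [|m].
        - exists (Fin 0); split; [|omp]. rewrite time_warp_zero by assumption.
          destruct x as [[|]|]; omp.
        - apply NNPP; intros H. specialize (Hl (Fin m)). cbn in Hl.
          enough (S m <= m) by lia. apply Hl. intros y Hy.
          destruct (leo_total y (Fin m)) as [|Hle]; [auto|].
          destruct (classic (leo (Fin (S m)) y)) as [|Hn]; [destruct H; eauto|].
          destruct y; omp. }
      eapply leo_lto_trans; [|eassumption]. now apply time_warp_mono.
    + apply NNPP; intros H. specialize (Hub (Fin (S m)) H). omp.
  - intros [H1 H2]. apply leo_antisym; [|auto]. apply Hl. intros y Hy.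
    apply NNPP; intros Hn. apply Hy. eapply leo_trans; [exact H2|].
    apply time_warp_mono; [assumption|]. destruct y; omp.
Qed.

(** If the arguments with value below n have supremum omega, then [f] preserves this supremum, so
    f(omega) is at most n - 1. *)
Lemma star_finite_eq_om f n :
  time_warp f -> star f (Fin n) = Om <-> lto (f Om) (Fin n).
Proof.
  intros Hf. destruct (star_lub f (Fin n) Hf) as [Hub Hl]. split.
  - intros E. rewrite E in *. destruct n as [|n].
    { exfalso. apply (Hl (Fin 0)). intros y Hy. destruct (f y); omp. }
    enough (leo (f Om) (Fin n)) by (destruct (f Om); omp).
    apply (Hf _ _ (conj Hub Hl)). intros z (y & Hy & ->). destruct (f y); omp.
  - intros H. specialize (Hub Om H). destruct (star f (Fin n)); omp.
Qed.

(** * Finiteness at finite arguments, operation by operation *)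

Definition finitary (f : omp -> omp) : Prop := forall n, f (Fin n) <> Om.

(** This is the infinitary case: a finite argument with value omega bounds all arguments with finite
    value, and without such an argument the latter are unbounded. *)
Lemma star_om_eq_om f : time_warp f -> star f Om = Om <-> finitary f.
Proof.
  intros Hf. destruct (star_lub f Om Hf) as [Hub Hl]. split.
  - intros E n Hn. rewrite E in *. apply (Hl (Fin n)). intros y Hy.
    apply NNPP; intros Hny. apply Hy. rewrite <- Hn.
    apply time_warp_mono; [assumption|]. destruct y; omp.
  - intros H. destruct (star f Om) as [m|]; [|reflexivity]. exfalso.
    enough (leo (Fin (S m)) (Fin m)) by omp. apply Hub.
    specialize (H (S m)). destruct (f _); omp.
Qed.

Lemma not_finitary f : ~ finitary f <-> exists n, f (Fin n) = Om.
Proof.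
  split.
  - intros H. apply not_all_ex_not in H as [n Hn]. exists n. now apply NNPP.
  - intros [n Hn] H. exact (H n Hn).
Qed.

Lemma finitary_star f : time_warp f -> finitary (star f) <-> f Om = Om.
Proof.
  intros Hf. split.
  - intros H. destruct (f Om) as [k|] eqn:E; [|reflexivity].
    exfalso; apply (H (S k)). apply star_finite_eq_om; [assumption|]. rewrite E; omp.
  - intros E n Hn. apply star_finite_eq_om in Hn; [|assumption]. rewrite E in Hn; omp.
Qed.

Lemma finitary_meet f g :
  time_warp f -> time_warp g ->
  finitary (fun x => minO (f x) (g x)) <-> finitary f \/ finitary g.
Proof.
  intros Hf Hg. split.
  - intros H. apply NNPP; intros Hn.
    apply not_or_and in Hn as [[n Hn]%not_finitary [m Hm]%not_finitary].
    apply (H (n + m)).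
    pose proof (time_warp_mono f (Fin n) (Fin (n + m)) Hf) as Hn'.
    pose proof (time_warp_mono g (Fin m) (Fin (n + m)) Hg) as Hm'.
    rewrite Hn in Hn'; rewrite Hm in Hm'; cbn in *.
    destruct (f (Fin (n + m))), (g (Fin (n + m)));
      first [reflexivity | exfalso; first [apply Hn'; lia | apply Hm'; lia]].
  - intros [H|H] n; specialize (H n); destruct (f (Fin n)), (g (Fin n)); omp.
Qed.

Lemma finitary_join f g :
  finitary (fun x => maxO (f x) (g x)) <-> finitary f /\ finitary g.
Proof.
  split.
  - intros H; split; intros n E; apply (H n); rewrite E; [|destruct (f _)]; reflexivity.
  - intros [H1 H2] n. specialize (H1 n); specialize (H2 n).
    destruct (f (Fin n)), (g (Fin n)); omp.
Qed.

Lemma time_warp_unbounded f n : time_warp f -> f Om = Om -> exists k, leo (Fin n) (f (Fin k)).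
Proof.
  intros Hf E. apply NNPP; intros H.
  enough (leo (f Om) (Fin n)) by (rewrite E in *; omp).
  apply time_warp_cont; [assumption|]. intros k.
  destruct (leo_total (f (Fin k)) (Fin n)); [auto|]. destruct H; eauto.
Qed.

Lemma time_warp_attained f :
  time_warp f -> f Om <> Om \/ ~ finitary f -> exists k, f (Fin k) = f Om.
Proof.
  intros Hf [H|[k Hk]%not_finitary].
  - apply NNPP; intros Hn.
    destruct (f Om) as [[|c]|] eqn:E; [| |tauto].
    + apply Hn. exists 0. now apply time_warp_zero.
    + enough (leo (f Om) (Fin c)) by (rewrite E in *; omp).
      apply time_warp_cont; [assumption|]. intros k.
      pose proof (time_warp_mono f (Fin k) Om Hf I) as Hk. rewrite E in Hk.
      destruct (f (Fin k)) as [m|] eqn:Em; [|omp]. cbn in *.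
      destruct (Nat.eq_dec m (S c)) as [->|]; [destruct Hn; eauto|lia].
  - exists k. rewrite Hk. pose proof (time_warp_mono f (Fin k) Om Hf I) as H.
    rewrite Hk in H. destruct (f Om); omp.
Qed.

Lemma finitary_comp_unbounded f g :
  time_warp f -> time_warp g -> finitary g -> g Om = Om ->
  finitary (fun x => f (g x)) <-> finitary f.
Proof.
  intros Hf Hg Fg E. split.
  - intros H n Hn. destruct (time_warp_unbounded g n Hg E) as [k Hk].
    apply (H k). apply (time_warp_mono f) in Hk; [|assumption].
    rewrite Hn in Hk. destruct (f (g _)); omp.
  - intros H n. specialize (Fg n). destruct (g (Fin n)); [apply H|tauto].
Qed.

(** The case complementary to [finitary_comp_unbounded]: with g(k) = g(omega) at a finite k,
    f(g(omega)) is itself the largest value of the composite at finite arguments. *)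
Lemma finitary_comp_attained f g :
  time_warp f -> time_warp g -> g Om <> Om \/ ~ finitary g ->
  finitary (fun x => f (g x)) <-> f (g Om) <> Om.
Proof.
  intros Hf Hg H. destruct (time_warp_attained g Hg H) as [k Hk]. split.
  - intros HF. rewrite <- Hk. apply HF.
  - intros HF n E. apply HF.
    pose proof (time_warp_mono g (Fin n) Om Hg I) as H'.
    apply (time_warp_mono f) in H'; [|assumption]. rewrite E in H'. destruct (f (g Om)); omp.
Qed.

(** * Closure of time warps under the term operations *)

Lemma time_warp_meet f g :
  time_warp f -> time_warp g -> time_warp (fun x => minO (f x) (g x)).
Proof.
  intros Hf Hg. apply time_warp_intro.
  - intros x y H. pose proof (time_warp_mono f _ _ Hf H). pose proof (time_warp_mono g _ _ Hg H).
    destruct (f x), (f y), (g x), (g y); omp.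
  - now rewrite (time_warp_zero f Hf), (time_warp_zero g Hg).
  (* If both functions exceed [u] at omega, each does so at some finite argument, and both do at the
     sum of these arguments. *)
  - intros u Hu. apply NNPP; intros Hn.
    assert (Hlt : forall h : omp -> omp, time_warp h -> ~ leo (h Om) u ->
      exists n, ~ leo (h (Fin n)) u).
    { intros h Hh Hhu. apply not_all_ex_not. intros H. now apply Hhu, time_warp_cont. }
    destruct (Hlt f Hf) as [n Hfn]; [destruct (f Om), (g Om), u; omp|].
    destruct (Hlt g Hg) as [m Hgm]; [destruct (f Om), (g Om), u; omp|].
    specialize (Hu (n + m)).
    assert (Hf' : leo (f (Fin n)) (f (Fin (n + m)))) by (apply time_warp_mono; omp).
    assert (Hg' : leo (g (Fin m)) (g (Fin (n + m)))) by (apply time_warp_mono; omp).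
    destruct (f (Fin n)), (g (Fin m)), (f (Fin (n + m))), (g (Fin (n + m))), u; omp.
Qed.

Lemma time_warp_join f g :
  time_warp f -> time_warp g -> time_warp (fun x => maxO (f x) (g x)).
Proof.
  intros Hf Hg. apply time_warp_intro.
  - intros x y H. pose proof (time_warp_mono f _ _ Hf H). pose proof (time_warp_mono g _ _ Hg H).
    destruct (f x), (f y), (g x), (g y); omp.
  - now rewrite (time_warp_zero f Hf), (time_warp_zero g Hg).
  - intros u Hu.
    assert (leo (f Om) u) by (apply time_warp_cont; [assumption|]; intros n; specialize (Hu n);
      destruct (f (Fin n)), (g (Fin n)), u; omp).
    assert (leo (g Om) u) by (apply time_warp_cont; [assumption|]; intros n; specialize (Hu n);
      destruct (f (Fin n)), (g (Fin n)), u; omp).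
    destruct (f Om), (g Om), u; omp.
Qed.

Lemma time_warp_comp f g : time_warp f -> time_warp g -> time_warp (fun x => f (g x)).
Proof.
  intros Hf Hg S x HS. specialize (Hf _ _ (Hg _ _ HS)) as [H1 H2]. split.
  - intros z (y & Sy & ->). apply H1. eauto.
  - intros u Hu. apply H2. intros z (w & (y & Sy & ->) & ->). eauto.
Qed.

Lemma time_warp_id : time_warp (fun x => x).
Proof. apply time_warp_intro; auto. intros [n|] H; [specialize (H (S n))|]; omp. Qed.

Lemma time_warp_eval a s : (forall n, time_warp (a n)) -> time_warp (evalT a s).
Proof.
  intros Ha; induction s; cbn; auto using time_warp_meet, time_warp_join,
    time_warp_comp, time_warp_star, time_warp_id.
Qed.

(** * Finite tables of values *)

(* A table [R] records finitely many facts about a term with code [e]. For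
   [x, y <= K], [R e x y] says that the term maps [x] to [y], where [K] stands for
   omega. [R e (S K) y] says that the value of the term is finite on all finite
   arguments if [y = 1], and that it is not if [y = 0]. *)
Definition value_ok (R : nat -> nat -> nat -> Prop) (K a b x y : nat) : Prop :=
  (R (cpair 0 a) x y ->
     (x <= 0 -> y <= 0) /\
     forall x', x' <= K -> forall y', y' <= K ->
       R (cpair 0 a) x' y' -> x <= x' -> y <= y') /\
  (R (cpair 1 (cpair a b)) x y ->
     exists u, u <= K /\ exists v, v <= K /\
       (R a x u /\ R b x v /\ y = u - (u - v))) /\
  (R (cpair 2 (cpair a b)) x y ->
     exists u, u <= K /\ exists v, v <= K /\
       (R a x u /\ R b x v /\ y = u + (v - u))) /\
  (R (cpair 3 (cpair a b)) x y -> exists u, u <= K /\ (R b x u /\ R a u y)) /\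
  (R (cpair 4 a) x y ->
     (x <= 0 /\ y <= 0) \/
     (1 <= x /\ 2 + y <= K /\
        exists u, u <= K /\ exists v, v <= K /\
          (R a y u /\ R a (1 + y) v /\ 1 + u <= x /\ x <= v)) \/
     (1 + x <= K /\ y = K /\ exists u, u <= K /\ (R a K u /\ 1 + u <= x)) \/
     (x = K /\ y = K /\ R a (1 + K) 1)) /\
  (R (cpair 5 0) x y -> y = x).

(** On flags, [u + (v - u)] is disjunction and [u - (u - v)] conjunction. For a variable, flag 0
    demands a recorded witness and flag 1 forbids one; [finitary_ext] shows that forbidding is
    enough. *)
Definition flag_ok (R : nat -> nat -> nat -> Prop) (K a b y : nat) : Prop :=
  (R (cpair 0 a) (1 + K) y ->
     (y = 0 /\ exists x', x' <= K /\ (1 + x' <= K /\ R (cpair 0 a) x' K)) \/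
     (y = 1 /\ forall x', x' <= K -> forall y', y' <= K ->
        1 + x' <= K -> R (cpair 0 a) x' y' -> 1 + y' <= K)) /\
  (R (cpair 1 (cpair a b)) (1 + K) y ->
     exists u, u <= K /\ exists v, v <= K /\
       (R a (1 + K) u /\ R b (1 + K) v /\ y = u + (v - u))) /\
  (R (cpair 2 (cpair a b)) (1 + K) y ->
     exists u, u <= K /\ exists v, v <= K /\
       (R a (1 + K) u /\ R b (1 + K) v /\ y = u - (u - v))) /\
  (R (cpair 3 (cpair a b)) (1 + K) y ->
     (R b (1 + K) 1 /\ R b K K /\ R a (1 + K) y) \/
     (exists u, u <= K /\ exists v, v <= K /\
        (R b K u /\ (1 + u <= K \/ R b (1 + K) 0) /\ R a u v /\
         ((y = 0 /\ K <= v) \/ (y = 1 /\ 1 + v <= K))))) /\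
  (R (cpair 4 a) (1 + K) y ->
     exists u, u <= K /\
       (R a K u /\ ((y = 0 /\ 1 + u <= K) \/ (y = 1 /\ K <= u)))) /\
  (R (cpair 5 0) (1 + K) y -> y = 1).

(** Ranging over all codes up to [N] instead of terms keeps this arithmetical; subterms are reached
    since their codes are no larger. *)
Definition consistent (R : nat -> nat -> nat -> Prop) (K N : nat) : Prop :=
  forall a, a <= N -> forall b, b <= N -> forall x, x <= K -> forall y, y <= K ->
    value_ok R K a b x y /\ flag_ok R K a b y.

(** * From a consistent table to an assignment of time warps *)

Definition dec (K x : nat) : omp := if x <? K then Fin x else Om.

Lemma dec_fin K x : x < K -> dec K x = Fin x.
Proof. unfold dec; intros; destruct (Nat.ltb_spec x K); [reflexivity | lia]. Qed.

Lemma dec_om K x : K <= x -> dec K x = Om.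
Proof. unfold dec; intros; destruct (Nat.ltb_spec x K); [lia | reflexivity]. Qed.

Lemma dec_le K x y : x <= K -> y <= K -> leo (dec K x) (dec K y) <-> x <= y.
Proof.
  unfold dec; destruct (Nat.ltb_spec x K), (Nat.ltb_spec y K); omp.
Qed.

(* The suprema of these sets form a time warp that extends the recorded values [r].
   The second clause makes it grow up to the largest recorded value beyond [K]: the
   value at omega is then reached as a supremum even if it exceeds all recorded
   values at finite arguments. *)
Definition ext_set (K : nat) (r : nat -> nat -> Prop) (p : omp) (z : omp) : Prop :=
  (exists x y, 0 < x <= K /\ y <= K /\ r x y /\ leo (dec K x) p /\ z = dec K y) \/
  (exists x y m, x <= K /\ y <= K /\ r x y /\ leo (Fin K) p /\ leo (Fin m) p /\
     leo (Fin m) (dec K y) /\ z = Fin m).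

Definition ext (K : nat) (r : nat -> nat -> Prop) (p : omp) : omp :=
  epsilon (inhabits Om) (is_lub (ext_set K r p)).

Lemma ext_lub K r p : is_lub (ext_set K r p) (ext K r p).
Proof. unfold ext; apply epsilon_spec, lub_exists. Qed.

Lemma leo_of_fin z u : (forall m, leo (Fin m) z -> leo (Fin m) u) -> leo z u.
Proof.
  destruct z as [n|], u as [k|]; intros H; omp.
  - now apply (H n).
  - specialize (H (S k) I). lia.
Qed.

(** Continuity is what the second clause of [ext_set] achieves: a finite [m] below a recorded value
    is already reached at the argument K + m. *)
Lemma time_warp_ext K r : 0 < K -> time_warp (ext K r).
Proof.
  intros HK. apply time_warp_intro.
  - intros p q Hpq. apply (ext_lub K r p). intros z Hz. apply (ext_lub K r q).
    destruct Hz as [(x & y & ? & ? & ? & ? & ->)|(x & y & m & ? & ? & ? & ? & ? & ? & ->)].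
    + left. exists x, y. intuition eauto using leo_trans.
    + right. exists x, y, m. intuition eauto using leo_trans.
  - apply leo_antisym; [|destruct (ext _ _ _); omp].
    apply (ext_lub K r (Fin 0)).
    intros z [(x & y & ? & ? & ? & H & ->)|(x & y & m & ? & ? & ? & H & ? & ? & ->)].
    + unfold dec in H. destruct (x <? K); cbn in H; [lia | tauto].
    + cbn in H; lia.
  - intros u Hu. apply (ext_lub K r Om). intros z Hz. apply leo_of_fin. intros m Hm.
    apply leo_trans with (ext K r (Fin (K + m))); [|apply Hu].
    apply (ext_lub K r (Fin (K + m))).
    destruct Hz as [(x & y & ? & ? & ? & ? & ->)|(x & y & m' & ? & ? & ? & ? & ? & ? & ->)];
      right; exists x, y, m; intuition (eauto using leo_trans; cbn; lia).
Qed.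

(** For x < K the second clause of [ext_set] does not apply; for x = K it stays below recorded
    values, which are at most [y] by monotonicity. *)
Lemma ext_extends K (r : nat -> nat -> Prop) x y :
  0 < K -> x <= K -> y <= K -> r x y -> (x = 0 -> y = 0) ->
  (forall x1 y1 x2 y2, x1 <= K -> y1 <= K -> x2 <= K -> y2 <= K ->
     r x1 y1 -> r x2 y2 -> x1 <= x2 -> y1 <= y2) ->
  ext K r (dec K x) = dec K y.
Proof.
  intros HK Hx Hy Hr H0 Hmono. apply leo_antisym.
  - apply (ext_lub K r).
    intros z [(x' & y' & ? & ? & ? & H & ->)|(x' & y' & m & ? & ? & ? & H & ? & ? & ->)].
    + apply dec_le; try lia. apply dec_le in H; try lia.
      apply (Hmono x' y' x y); auto; lia.
    + eapply leo_trans; [eassumption|]. apply dec_le; try lia.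
      assert (K <= x) by (destruct (Nat.lt_ge_cases x K); [rewrite dec_fin in H by lia; cbn in H; lia | lia]).
      apply (Hmono x' y' x y); auto; lia.
  - destruct (Nat.eq_dec x 0) as [->|].
    + rewrite H0, (dec_fin K 0) by lia. destruct (ext _ _ _); omp.
    + apply (ext_lub K r). left. exists x, y.
      repeat split; auto; try lia. apply leo_refl.
Qed.

(** At a finite argument n, the first clause of [ext_set] contributes values below K and the second
    at most n, so K + n is a bound. *)
Lemma finitary_ext K (r : nat -> nat -> Prop) :
  (forall x y, x <= K -> y <= K -> x < K -> r x y -> y < K) -> finitary (ext K r).
Proof.
  intros H n E. pose proof (ext_lub K r (Fin n)) as [_ Hl]. rewrite E in Hl.
  apply (Hl (Fin (K + n))).
  intros z [(x & y & ? & ? & ? & Hx & ->)|(x & y & m & ? & ? & ? & ? & ? & ? & ->)]; [|omp].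
  destruct (Nat.lt_ge_cases x K).
  - rewrite dec_fin by (apply (H x y); auto; lia). cbn. specialize (H x y); lia.
  - rewrite dec_om in Hx by lia. omp.
Qed.

Definition flag (f : omp -> omp) (y : nat) : Prop :=
  (y = 0 /\ ~ finitary f) \/ (y = 1 /\ finitary f).


(** By induction on the term, each clause of [consistent] being the decoded rule of one operation.
    That recorded values of a variable are single-valued comes from its monotonicity clause, applied
    both ways to equal arguments. *)
Lemma table_sound R K N a :
  1 < K -> consistent R K N ->
  (forall n, a n = ext K (R (cpair 0 n))) -> (forall n, time_warp (a n)) ->
  forall s, enc s <= N -> forall x y, y <= K -> R (enc s) x y ->
    (x <= K -> evalT a s (dec K x) = dec K y) /\
    (x = S K -> flag (evalT a s) y).
Proof.
  intros HK HR Ha Htw. induction s as [n|s IHs t IHt|s IHs t IHt|s IHs t IHt|s IHs|];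
    cbn [enc]; intros HN x y Hy HRe.
  - assert (Hn : n <= N) by (pose proof (cpair_add_le 0 n); lia).
    cbn [evalT]. rewrite Ha.
    assert (Hval : forall x y, x <= K -> y <= K -> R (cpair 0 n) x y ->
              ext K (R (cpair 0 n)) (dec K x) = dec K y).
    { intros x1 y1 Hx1 Hy1 H1. apply ext_extends; auto; try lia.
      - destruct (HR n Hn n Hn x1 Hx1 y1 Hy1) as [[Hv _] _].
        specialize (Hv H1) as [Hv _]. lia.
      - intros x2 y2 x3 y3 Hx2 Hy2 Hx3 Hy3 H2 H3 Hle.
        destruct (HR n Hn n Hn x2 Hx2 y2 Hy2) as [[Hv _] _]. now apply (Hv H2) with x3. }
    split; [auto|]. intros ->.
    (* [flag_ok] does not mention the argument [x], so 0 serves as a dummy. *)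
    destruct (HR n Hn n Hn 0 (Nat.le_0_l _) y Hy) as [_ [Hf _]].
    destruct (Hf HRe) as [(-> & x' & Hx' & Hlt & H)|(-> & H)].
    + left; split; [reflexivity|]. apply not_finitary. exists x'.
      rewrite <- (dec_fin K x') by lia. rewrite (Hval x' K) by auto. apply dec_om; lia.
    + right; split; [reflexivity|]. apply finitary_ext. intros x1 y1 Hx1 Hy1 Hlt Hr. exact (H x1 Hx1 y1 Hy1 Hlt Hr).
  - pose proof (cpair_add_le 1 (cpair (enc s) (enc t))).
    pose proof (cpair_add_le (enc s) (enc t)).
    assert (Hs : enc s <= N) by lia. assert (Ht : enc t <= N) by lia.
    split.
    + intros Hx. destruct (HR _ Hs _ Ht x Hx y Hy) as [(_ & Hv & _) _].
      destruct (Hv HRe) as (u & Hu & v & Hv' & H1 & H2 & ->). cbn [evalT].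
      rewrite (proj1 (IHs Hs x u Hu H1) Hx), (proj1 (IHt Ht x v Hv' H2) Hx).
      unfold dec. destruct (Nat.ltb_spec u K), (Nat.ltb_spec v K), (Nat.ltb_spec (u - (u - v)) K);
        omp; f_equal; lia.
    + intros ->. destruct (HR _ Hs _ Ht 0 (Nat.le_0_l _) y Hy) as [_ (_ & Hf & _)].
      destruct (Hf HRe) as (u & Hu & v & Hv' & H1 & H2 & ->). cbn [evalT].
      pose proof (proj2 (IHs Hs _ u Hu H1) eq_refl) as F1.
      pose proof (proj2 (IHt Ht _ v Hv' H2) eq_refl) as F2.
      unfold flag in *. rewrite finitary_meet by now apply time_warp_eval.
      destruct F1 as [[-> ?]|[-> ?]], F2 as [[-> ?]|[-> ?]]; cbn; tauto.
  - pose proof (cpair_add_le 2 (cpair (enc s) (enc t))).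
    pose proof (cpair_add_le (enc s) (enc t)).
    assert (Hs : enc s <= N) by lia. assert (Ht : enc t <= N) by lia.
    split.
    + intros Hx. destruct (HR _ Hs _ Ht x Hx y Hy) as [(_ & _ & Hv & _) _].
      destruct (Hv HRe) as (u & Hu & v & Hv' & H1 & H2 & ->). cbn [evalT].
      rewrite (proj1 (IHs Hs x u Hu H1) Hx), (proj1 (IHt Ht x v Hv' H2) Hx).
      unfold dec. destruct (Nat.ltb_spec u K), (Nat.ltb_spec v K), (Nat.ltb_spec (u + (v - u)) K);
        omp; f_equal; lia.
    + intros ->. destruct (HR _ Hs _ Ht 0 (Nat.le_0_l _) y Hy) as [_ (_ & _ & Hf & _)].
      destruct (Hf HRe) as (u & Hu & v & Hv' & H1 & H2 & ->). cbn [evalT].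
      pose proof (proj2 (IHs Hs _ u Hu H1) eq_refl) as F1.
      pose proof (proj2 (IHt Ht _ v Hv' H2) eq_refl) as F2.
      unfold flag in *. rewrite finitary_join.
      destruct F1 as [[-> ?]|[-> ?]], F2 as [[-> ?]|[-> ?]]; cbn; tauto.
  - pose proof (cpair_add_le 3 (cpair (enc s) (enc t))).
    pose proof (cpair_add_le (enc s) (enc t)).
    assert (Hs : enc s <= N) by lia. assert (Ht : enc t <= N) by lia.
    specialize (IHs Hs). specialize (IHt Ht).
    split.
    + intros Hx. destruct (HR _ Hs _ Ht x Hx y Hy) as [(_ & _ & _ & Hv & _) _].
      destruct (Hv HRe) as (u & Hu & H1 & H2). cbn [evalT].
      rewrite (proj1 (IHt x u Hu H1) Hx). now apply IHs.
    + intros ->. destruct (HR _ Hs _ Ht 0 (Nat.le_0_l _) y Hy) as [_ (_ & _ & _ & Hf & _)].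
      cbn [evalT]. unfold flag.
      assert (Hdec : dec K K = Om) by (apply dec_om; lia).
      destruct (Hf HRe) as [(H1 & H2 & H3)|(u & Hu & v & Hv & H1 & H2 & H3 & H4)].
      * pose proof (proj2 (IHt _ _ (Nat.lt_le_incl _ _ HK) H1) eq_refl) as H1'.
        pose proof (proj1 (IHt _ _ (le_n K) H2) (le_n K)) as H2'. rewrite Hdec in H2'.
        destruct H1' as [[? _]|[_ H1']]; [lia|].
        rewrite finitary_comp_unbounded by (auto using time_warp_eval).
        exact (proj2 (IHs _ _ Hy H3) eq_refl).
      * apply (fun H => proj1 (IHt _ _ Hu H) (le_n K)) in H1. rewrite Hdec in H1.
        apply (fun H => proj1 (IHs _ _ Hv H) Hu) in H3.
        assert (H2' : evalT a t Om <> Om \/ ~ finitary (evalT a t)).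
        { destruct H2 as [H2|H2].
          - left. rewrite H1, dec_fin by lia. discriminate.
          - right. destruct (proj2 (IHt _ _ (Nat.le_0_l K) H2) eq_refl) as [[_ ?]|[? _]]; auto; lia. }
        rewrite finitary_comp_attained by (auto using time_warp_eval).
        rewrite H1, H3.
        destruct H4 as [[-> H4]|[-> H4]]; [left|right]; (split; [reflexivity|]).
        -- rewrite dec_om by lia. tauto.
        -- rewrite dec_fin by lia. discriminate.
  - pose proof (cpair_add_le 4 (enc s)).
    assert (Hs : enc s <= N) by lia. specialize (IHs Hs).
    assert (Hts : time_warp (evalT a s)) by now apply time_warp_eval.
    assert (Hdec : dec K K = Om) by (apply dec_om; lia).
    split; cbn [evalT].
    + intros Hx. destruct (HR _ Hs _ Hs x Hx y Hy) as [(_ & _ & _ & _ & Hv & _) _].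
      destruct (Hv HRe) as [[H1 H2]|[(H1 & H2 & u & Hu & v & Hv' & H3 & H4 & H5 & H6)|
        [(H1 & -> & u & Hu & H2 & H3)|(-> & -> & H1)]]].
      * assert (x = 0) as -> by lia. assert (y = 0) as -> by lia.
        rewrite dec_fin by lia. apply time_warp_zero. now apply time_warp_star.
      (* By 2 + y <= K, both [y] and [1 + y] decode to finite numbers, which makes the second a true
         successor. *)
      * assert (Hy1 : 1 + y <= K) by lia.
        apply (fun H => proj1 (IHs _ _ Hu H) Hy) in H3.
        apply (fun H => proj1 (IHs _ _ Hv' H) Hy1) in H4.
        rewrite (dec_fin K y) in * by lia. rewrite (dec_fin K (1 + y)) in H4 by lia.
        apply star_eq_fin; [assumption| |].
        { unfold dec; destruct (x <? K); [|discriminate]. intros E; injection E; lia. }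
        cbn in H4. rewrite H3, H4. unfold lto. rewrite !dec_le by lia. lia.
      * apply (fun H => proj1 (IHs _ _ Hu H) (le_n K)) in H2.
        rewrite Hdec in *. rewrite (dec_fin K x), (dec_fin K u) in * by lia.
        apply star_finite_eq_om; [assumption|]. rewrite H2. omp.
      * destruct (proj2 (IHs _ _ (Nat.lt_le_incl _ _ HK) H1) eq_refl) as [[? _]|[_ H1']]; [lia|].
        rewrite Hdec. now apply star_om_eq_om.
    + intros ->. destruct (HR _ Hs _ Hs 0 (Nat.le_0_l _) y Hy) as [_ (_ & _ & _ & _ & Hf & _)].
      destruct (Hf HRe) as (u & Hu & H1 & H2).
      apply (fun H => proj1 (IHs _ _ Hu H) (le_n K)) in H1. rewrite Hdec in H1.
      unfold flag. rewrite finitary_star, H1 by assumption.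
      destruct H2 as [[-> H2]|[-> H2]]; [left|right]; (split; [reflexivity|]).
      * rewrite dec_fin by lia. discriminate.
      * apply dec_om; lia.
  - assert (H0 : 0 <= N) by lia. split; cbn [evalT].
    + intros Hx. destruct (HR _ H0 _ H0 x Hx y Hy) as [(_ & _ & _ & _ & _ & Hv) _].
      now rewrite (Hv HRe).
    + intros ->. destruct (HR _ H0 _ H0 0 (Nat.le_0_l _) y Hy) as [_ (_ & _ & _ & _ & _ & Hf)].
      right. split; [now apply Hf|]. intros n; discriminate.
Qed.

Lemma table_refutes R K N s t x y z :
  1 < K -> consistent R K N -> enc s <= N -> enc t <= N ->
  x <= K -> y <= K -> z <= K -> y <> z ->
  R (enc s) x y -> R (enc t) x z -> ~ W_models s t.
Proof.
  intros HK HR Hs Ht Hx Hy Hz Hne H1 H2 HW.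
  set (a := fun n => ext K (R (cpair 0 n))).
  assert (Ha : forall n, time_warp (a n)) by (intros n; apply time_warp_ext; lia).
  assert (H := table_sound R K N a HK HR (fun _ => eq_refl) Ha).
  specialize (HW a Ha (dec K x)).
  rewrite (proj1 (H s Hs x y Hy H1) Hx), (proj1 (H t Ht x z Hz H2) Hx) in HW.
  apply Hne, Nat.le_antisymm; apply (dec_le K); try assumption; rewrite HW; apply leo_refl.
Qed.

(** * Tables obtained from counterexamples *)

Definition succO (x : omp) : omp := match x with Fin n => Fin (S n) | Om => Om end.

(** For a function that is not finitary this supplies the witness that flag 0 of a variable demands;
    otherwise it is an arbitrary number and only adds a sample. *)
Definition pole (f : omp -> omp) : nat :=
  epsilon (inhabits 0) (fun k => f (Fin k) = Om).

(* A sample is a term with an argument, or with [None] to ask whether its value is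
   finitary. The children of a sample are the samples that determine it. *)
Definition children (a : nat -> omp -> omp) (s : term) (q : option omp) :
    list (term * option omp) :=
  match s, q with
  | TVar n, None => [(s, Some (Fin (pole (a n))))]
  | TVar _, Some _ => []
  | TMeet s t, _ | TJoin s t, _ => [(s, q); (t, q)]
  | TMul s t, Some p => [(t, q); (s, Some (evalT a t p))]
  | TMul s t, None => [(t, Some Om); (s, Some (evalT a t Om)); (t, None); (s, None)]
  | TStar s, Some p =>
      [(s, Some (star (evalT a s) p)); (s, Some (succO (star (evalT a s) p))); (s, None)]
  | TStar s, None => [(s, Some Om)]
  | TOne, _ => []
  end.

(** Recursion on the term reaches the closure under [children], because demands pass to proper
    subterms, except for the pole of a variable, which has no demands of its own. *)
Fixpoint samples (a : nat -> omp -> omp) (s : term) (q : option omp) :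
    list (term * option omp) :=
  (s, q) ::
  match s, q with
  | TVar n, None => [(s, Some (Fin (pole (a n))))]
  | TVar _, Some _ => []
  | TMeet s t, _ | TJoin s t, _ => samples a s q ++ samples a t q
  | TMul s t, Some p => samples a t q ++ samples a s (Some (evalT a t p))
  | TMul s t, None =>
      samples a t (Some Om) ++ samples a s (Some (evalT a t Om)) ++
      samples a t None ++ samples a s None
  | TStar s, Some p =>
      samples a s (Some (star (evalT a s) p)) ++
      samples a s (Some (succO (star (evalT a s) p))) ++ samples a s None
  | TStar s, None => samples a s (Some Om)
  | TOne, _ => []
  end.

Definition closed (a : nat -> omp -> omp) (L : list (term * option omp)) : Prop :=
  forall s q, In (s, q) L -> incl (children a s q) L.

Lemma closed_app a L M : closed a L -> closed a M -> closed a (L ++ M).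
Proof.
  intros HL HM s q [H|H]%in_app_or; [apply incl_appl | apply incl_appr]; auto.
Qed.

Lemma closed_cons a L s q :
  closed a L -> incl (children a s q) ((s, q) :: L) -> closed a ((s, q) :: L).
Proof.
  intros HL Hi s' q' [E|H]; [now injection E as <- <-|]. apply incl_tl. auto.
Qed.

Lemma samples_self a s q : In (s, q) (samples a s q).
Proof. destruct s; left; reflexivity. Qed.

Lemma samples_closed a s q : closed a (samples a s q).
Proof.
  revert q; induction s; intros [p|]; cbn [samples];
    (apply closed_cons;
      [repeat apply closed_app; auto |
       intros z Hz; cbn [children] in Hz; cbn in Hz;
       repeat destruct Hz as [<-|Hz]; try contradiction; right;
       rewrite ?in_app_iff; auto using samples_self]).
  - intros ? ? [].
  - intros s q [E|[]]. injection E as <- <-. intros ? [].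
  - now left.
  - intros ? ? [].
  - intros ? ? [].
Qed.

Lemma samples_enc a s q s' q' : In (s', q') (samples a s q) -> enc s' <= enc s.
Proof.
  revert q; induction s as [n|s IHs t IHt|s IHs t IHt|s IHs t IHt|s IHs|]; intros q;
    cbn [samples enc]; (intros [E|H]; [injection E as <- <-; reflexivity|]).
  - destruct q; [contradiction|]. destruct H as [E|[]]; injection E as <- <-; reflexivity.
  - pose proof (cpair_add_le 1 (cpair (enc s) (enc t))). pose proof (cpair_add_le (enc s) (enc t)).
    apply in_app_or in H as [H|H]; [apply IHs in H | apply IHt in H]; lia.
  - pose proof (cpair_add_le 2 (cpair (enc s) (enc t))). pose proof (cpair_add_le (enc s) (enc t)).
    apply in_app_or in H as [H|H]; [apply IHs in H | apply IHt in H]; lia.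
  - pose proof (cpair_add_le 3 (cpair (enc s) (enc t))). pose proof (cpair_add_le (enc s) (enc t)).
    destruct q; rewrite !in_app_iff in H;
      repeat destruct H as [H|H]; first [apply IHs in H | apply IHt in H]; lia.
  - pose proof (cpair_add_le 4 (enc s)).
    destruct q; rewrite ?in_app_iff in H; repeat destruct H as [H|H]; apply IHs in H; lia.
  - destruct q; contradiction.
Qed.

(** Since [cpair c k] is at least c + k, a constructor with tag c gains a factor 4^c over the bounds
    of its subterms, which absorbs its recursive calls. The factor 2 is for the variable with code
    0, which can yield two samples. *)
Lemma samples_length a s q : length (samples a s q) <= 2 * 4 ^ enc s.
Proof.
  assert (Hpos : forall n, 1 <= 4 ^ n) by (intros n; pose proof (Nat.pow_nonzero 4 n); lia).
  assert (Hpair : forall c m n, 4 ^ c * (4 ^ m * 4 ^ n) <= 4 ^ cpair c (cpair m n)).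
  { intros c m n. rewrite <- !Nat.pow_add_r. apply Nat.pow_le_mono_r; [lia|].
    pose proof (cpair_add_le c (cpair m n)). pose proof (cpair_add_le m n). lia. }
  revert q; induction s as [n|s IHs t IHt|s IHs t IHt|s IHs t IHt|s IHs|]; intros q;
    cbn [samples enc].
  - specialize (Hpos (cpair 0 n)). destruct q; cbn [length]; lia.
  - specialize (Hpair 1 (enc s) (enc t)). cbn [length]. rewrite length_app.
    specialize (IHs q). specialize (IHt q).
    pose proof (Hpos (enc s)). pose proof (Hpos (enc t)). cbn [Nat.pow] in Hpair. nia.
  - specialize (Hpair 2 (enc s) (enc t)). cbn [length]. rewrite length_app.
    specialize (IHs q). specialize (IHt q).
    pose proof (Hpos (enc s)). pose proof (Hpos (enc t)). cbn [Nat.pow] in Hpair. nia.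
  - specialize (Hpair 3 (enc s) (enc t)).
    change (4 ^ 3) with 64 in Hpair.
    pose proof (Hpos (enc s)). pose proof (Hpos (enc t)).
    assert (1 + 4 * 4 ^ enc s + 4 * 4 ^ enc t <= 9 * (4 ^ enc s * 4 ^ enc t)) by nia.
    destruct q as [p|]; cbn [length]; rewrite !length_app.
    + pose proof (IHt (Some p)). pose proof (IHs (Some (evalT a t p))). lia.
    + pose proof (IHt (Some Om)). pose proof (IHs (Some (evalT a t Om))).
      pose proof (IHt None). pose proof (IHs None). lia.
  - assert (4 ^ (4 + enc s) <= 4 ^ cpair 4 (enc s)) as H
      by (apply Nat.pow_le_mono_r; [lia | apply cpair_add_le]).
    rewrite Nat.pow_add_r in H. change (4 ^ 4) with 256 in H. pose proof (Hpos (enc s)).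
    destruct q as [p|]; cbn [length]; rewrite ?length_app.
    + pose proof (IHs (Some (star (evalT a s) p))).
      pose proof (IHs (Some (succO (star (evalT a s) p)))). pose proof (IHs None). lia.
    + pose proof (IHs (Some Om)). lia.
  - specialize (Hpos (cpair 5 0)). destruct q; cbn [length]; lia.
Qed.

(** * Compression of numbers to their ranks *)

Fixpoint rank (Q : list nat) (n : nat) : nat :=
  match n with
  | 0 => 0
  | S n => (if in_dec Nat.eq_dec n Q then 1 else 0) + rank Q n
  end.

Lemma rank_mono Q m n : m <= n -> rank Q m <= rank Q n.
Proof. induction 1; cbn; lia. Qed.

(** Successors survive compression: the rank of n + 1 is as required once n itself is recorded. *)
Lemma rank_succ Q n : In n Q -> rank Q (S n) = S (rank Q n).
Proof. intros H; cbn. destruct (in_dec Nat.eq_dec n Q); [reflexivity | contradiction]. Qed.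

Lemma rank_bound Q n : rank Q n <= length Q.
Proof.
  assert (exists l, NoDup l /\ (forall i, In i l -> In i Q /\ i < n) /\ length l = rank Q n)
    as (l & Hl & Hi & <-).
  { induction n as [|n (l & Hl & Hi & E)]; [exists []; repeat split; [constructor|..]; easy|].
    cbn. destruct (in_dec Nat.eq_dec n Q).
    - exists (n :: l); repeat split.
      + constructor; [|assumption]. intros H%Hi. lia.
      + destruct H as [<-|H%Hi]; tauto.
      + destruct H as [<-|H%Hi]; lia.
      + cbn; lia.
    - exists l; repeat split; auto; try apply Hi; auto. apply Hi in H; lia. }
  apply NoDup_incl_length; [assumption|]. intros i Hil. now apply Hi.
Qed.

Definition compress (Q : list nat) (K : nat) (p : omp) : nat :=
  match p with Fin n => rank Q n | Om => K end.

Definition covered (Q : list nat) (p : omp) : Prop :=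
  match p with Fin n => In n Q | Om => True end.

(** The slack of 2 keeps a rank and its successor below K, the code of omega, as the clause for the
    involution requires. *)
Lemma compress_fin_lt Q K n : 2 + length Q <= K -> 2 + compress Q K (Fin n) <= K.
Proof. intros; cbn; pose proof (rank_bound Q n); lia. Qed.

Lemma compress_le_bound Q K p : 2 + length Q <= K -> compress Q K p <= K.
Proof. intros; destruct p; cbn; [pose proof (rank_bound Q n)|]; lia. Qed.

Lemma compress_mono Q K p q :
  2 + length Q <= K -> leo p q -> compress Q K p <= compress Q K q.
Proof.
  intros HK; destruct p as [m|], q as [n|]; cbn; try tauto; intros H.
  - now apply rank_mono.
  - pose proof (rank_bound Q m); lia.
  - lia.
Qed.

(** A smaller number that lies in [Q] is counted in the rank of the larger one but not in its
    own. *)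
Lemma compress_lt Q K p q :
  2 + length Q <= K -> covered Q p -> lto p q -> compress Q K p < compress Q K q.
Proof.
  intros HK; destruct p as [m|], q as [n|]; unfold lto; cbn; try tauto; intros Hp H.
  - pose proof (rank_mono Q (S m) n) as Hm. rewrite rank_succ in Hm by assumption. lia.
  - pose proof (rank_bound Q m); lia.
Qed.

Lemma compress_reflect Q K p q :
  2 + length Q <= K -> covered Q q -> compress Q K p <= compress Q K q -> leo p q.
Proof.
  intros HK Hq H. apply NNPP; intros Hn.
  pose proof (compress_lt Q K q p HK Hq Hn). lia.
Qed.

Lemma compress_min Q K p q :
  2 + length Q <= K ->
  compress Q K (minO p q) = compress Q K p - (compress Q K p - compress Q K q).
Proof.
  intros HK. destruct (leo_total p q) as [H|H]; pose proof (compress_mono Q K _ _ HK H).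
  - replace (minO p q) with p; [lia|]. destruct p, q; omp. f_equal; lia.
  - replace (minO p q) with q; [lia|]. destruct p, q; omp. f_equal; lia.
Qed.

Lemma compress_max Q K p q :
  2 + length Q <= K ->
  compress Q K (maxO p q) = compress Q K p + (compress Q K q - compress Q K p).
Proof.
  intros HK. destruct (leo_total p q) as [H|H]; pose proof (compress_mono Q K _ _ HK H).
  - replace (maxO p q) with q; [lia|]. destruct p, q; omp. f_equal; lia.
  - replace (maxO p q) with p; [lia|]. destruct p, q; omp. f_equal; lia.
Qed.

(** * The table of an assignment and its local conditions *)

Lemma flag_exists f : exists y, y <= 1 /\ flag f y.
Proof.
  unfold flag. destruct (classic (finitary f)); [exists 1 | exists 0]; auto.
Qed.

Lemma flag_le f y : flag f y -> y <= 1.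
Proof. unfold flag; lia. Qed.

(** Compressed arguments are at most K, so the row 1 + K is free for flags. *)
Definition table (a : nat -> omp -> omp) (L : list (term * option omp)) (Q : list nat)
    (K e x y : nat) : Prop :=
  exists s q, In (s, q) L /\ enc s = e /\
    match q with
    | Some p => x = compress Q K p /\ y = compress Q K (evalT a s p)
    | None => x = 1 + K /\ flag (evalT a s) y
    end.

Lemma enc_var s a : enc s = cpair 0 a -> s = TVar a.
Proof. destruct s; cbn [enc]; intros [H1 H2]%cpair_inj; congruence. Qed.

Lemma enc_one s a : enc s = cpair 5 a -> s = TOne.
Proof. destruct s; cbn [enc]; intros [H1 H2]%cpair_inj; congruence. Qed.

Lemma enc_star s a : enc s = cpair 4 a -> exists s', s = TStar s' /\ enc s' = a.
Proof. destruct s; cbn [enc]; intros [H1 H2]%cpair_inj; try discriminate; eauto. Qed.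

Lemma enc_meet s a b :
  enc s = cpair 1 (cpair a b) -> exists s1 s2, s = TMeet s1 s2 /\ enc s1 = a /\ enc s2 = b.
Proof.
  destruct s; cbn [enc]; intros [H1 H2]%cpair_inj; try discriminate. apply cpair_inj in H2; eauto.
Qed.

Lemma enc_join s a b :
  enc s = cpair 2 (cpair a b) -> exists s1 s2, s = TJoin s1 s2 /\ enc s1 = a /\ enc s2 = b.
Proof.
  destruct s; cbn [enc]; intros [H1 H2]%cpair_inj; try discriminate. apply cpair_inj in H2; eauto.
Qed.

Lemma enc_mul s a b :
  enc s = cpair 3 (cpair a b) -> exists s1 s2, s = TMul s1 s2 /\ enc s1 = a /\ enc s2 = b.
Proof.
  destruct s; cbn [enc]; intros [H1 H2]%cpair_inj; try discriminate. apply cpair_inj in H2; eauto.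
Qed.

Lemma table_value a L Q K s p :
  In (s, Some p) L -> table a L Q K (enc s) (compress Q K p) (compress Q K (evalT a s p)).
Proof. intros; exists s, (Some p); auto. Qed.

Lemma table_flag a L Q K s y :
  In (s, None) L -> flag (evalT a s) y -> table a L Q K (enc s) (1 + K) y.
Proof. intros; exists s, None; auto. Qed.

Lemma table_value_inv a L Q K e x y :
  x <= K -> table a L Q K e x y ->
  exists s p, In (s, Some p) L /\ enc s = e /\ x = compress Q K p /\
              y = compress Q K (evalT a s p).
Proof.
  intros Hx (s & [p|] & Hin & He & H); [exists s, p; tauto|]. lia.
Qed.

Lemma table_flag_inv a L Q K e y :
  2 + length Q <= K -> table a L Q K e (1 + K) y ->
  exists s, In (s, None) L /\ enc s = e /\ flag (evalT a s) y.
Proof.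
  intros HK (s & [p|] & Hin & He & H); [|exists s; tauto].
  pose proof (compress_le_bound Q K p HK). lia.
Qed.

Definition covers (a : nat -> omp -> omp) (Q : list nat) (L : list (term * option omp)) : Prop :=
  forall s p, In (s, Some p) L -> covered Q p /\ covered Q (evalT a s p).

Lemma table_value_ok a L Q K i j x y :
  (forall n, time_warp (a n)) -> closed a L -> covers a Q L -> In 0 Q ->
  2 + length Q <= K -> x <= K ->
  value_ok (table a L Q K) K i j x y.
Proof.
  intros Ha HL HQ H0 HK Hx.
  assert (Hb := fun p => compress_le_bound Q K p HK).
  (* Because 0 is in [Q], every positive number has positive rank; hence the 0 put into
     [support]. *)
  assert (Hz : forall p, compress Q K p <= 0 -> p = Fin 0).
  { intros p Hp. assert (H : leo p (Fin 0)) by (apply (compress_reflect Q K); auto).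
    destruct p; omp. f_equal; lia. }
  refine (conj _ (conj _ (conj _ (conj _ (conj _ _))))); intros HT;
    apply table_value_inv in HT as (s & p & Hin & He & -> & ->); auto.
  - apply enc_var in He as ->. split.
    + intros Hp%Hz. subst p. cbn. rewrite (time_warp_zero (a i)) by apply Ha. cbn; lia.
    + intros x' Hx' y' _ HT' Hle.
      apply table_value_inv in HT' as (s' & p' & Hin' & He' & -> & ->); auto.
      apply enc_var in He' as ->. apply compress_mono; auto.
      apply time_warp_mono; [apply Ha|]. apply (compress_reflect Q K); auto.
      now apply (HQ (TVar i)).
  - apply enc_meet in He as (s1 & s2 & -> & <- & <-). apply HL in Hin.
    exists (compress Q K (evalT a s1 p)); split; auto.
    exists (compress Q K (evalT a s2 p)); split; auto.
    split; [|split]; [apply table_value, Hin; cbn; auto ..|now apply compress_min].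
  - apply enc_join in He as (s1 & s2 & -> & <- & <-). apply HL in Hin.
    exists (compress Q K (evalT a s1 p)); split; auto.
    exists (compress Q K (evalT a s2 p)); split; auto.
    split; [|split]; [apply table_value, Hin; cbn; auto ..|now apply compress_max].
  - apply enc_mul in He as (s1 & s2 & -> & <- & <-). apply HL in Hin.
    exists (compress Q K (evalT a s2 p)); split; auto.
    split; cbn [evalT]; apply table_value, Hin; cbn; auto.
  - apply enc_star in He as (s' & -> & <-).
    destruct (HQ _ _ Hin) as [_ Hv]. apply HL in Hin. cbn [evalT] in *.
    assert (Hts : time_warp (evalT a s')) by now apply time_warp_eval.
    destruct (classic (p = Fin 0)) as [->|Hp].
    { left. rewrite time_warp_zero by now apply time_warp_star. cbn; lia. }
    right.
    assert (Hp' : 1 <= compress Q K p).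
    { destruct (Nat.lt_ge_cases 0 (compress Q K p)); [lia|]. destruct Hp; auto. }
    assert (Hin1 : In (s', Some (star (evalT a s') p)) L) by (apply Hin; cbn; auto).
    assert (Hin2 : In (s', Some (succO (star (evalT a s') p))) L) by (apply Hin; cbn; auto).
    assert (Hin3 : In (s', None) L) by (apply Hin; cbn; auto).
    destruct (star (evalT a s') p) as [m|] eqn:E.
    + left. apply star_eq_fin in E as [E1 E2]; auto.
      repeat split; auto using compress_fin_lt.
      exists (compress Q K (evalT a s' (Fin m))); split; auto.
      exists (compress Q K (evalT a s' (Fin (S m)))); split; auto.
      repeat split.
      * now apply table_value.
      * replace (1 + compress Q K (Fin m)) with (compress Q K (Fin (S m)))
          by now apply rank_succ. now apply table_value.
      * apply compress_lt; auto. now apply (HQ s').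
      * now apply compress_mono.
    + right. destruct p as [n|].
      * left. apply star_finite_eq_om in E; auto.
        split; [pose proof (compress_fin_lt Q K n HK); lia|]. split; [reflexivity|].
        exists (compress Q K (evalT a s' Om)); split; auto. split.
        -- now apply (table_value a L Q K s' Om).
        -- apply compress_lt; auto. now apply (HQ s').
      * right. repeat split; auto. apply star_om_eq_om in E; auto.
        apply table_flag; auto. right; auto.
  - now apply enc_one in He as ->.
Qed.

Lemma compress_om_iff Q K p : 2 + length Q <= K -> K <= compress Q K p <-> p = Om.
Proof.
  intros HK. split; [|intros ->; cbn; lia].
  intros H. destruct p as [n|]; [|reflexivity]. pose proof (compress_fin_lt Q K n HK). lia.
Qed.

Lemma table_flag_ok a L Q K i j y :
  (forall n, time_warp (a n)) -> closed a L -> 2 + length Q <= K ->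
  flag_ok (table a L Q K) K i j y.
Proof.
  intros Ha HL HK.
  assert (Hb := fun p => compress_le_bound Q K p HK).
  refine (conj _ (conj _ (conj _ (conj _ (conj _ _))))); intros HT;
    apply table_flag_inv in HT as (s & Hin & He & Hf); auto.
  - apply enc_var in He as ->. cbn [evalT] in Hf. apply HL in Hin.
    destruct Hf as [[-> Hf]|[-> Hf]]; [left|right]; (split; [reflexivity|]).
    + assert (Hpole : a i (Fin (pole (a i))) = Om).
      { unfold pole. apply epsilon_spec. now apply not_finitary. }
      exists (compress Q K (Fin (pole (a i)))); split; auto.
      split; [pose proof (compress_fin_lt Q K (pole (a i)) HK); lia|].
      pose proof (table_value a L Q K (TVar i) (Fin (pole (a i)))) as H.
      cbn [evalT] in H. rewrite Hpole in H. apply H. apply Hin. now left.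
    + intros x' Hx' y' _ Hlt HT'.
      apply table_value_inv in HT' as (s' & p' & Hin' & He' & -> & ->); auto.
      apply enc_var in He' as ->. cbn [evalT].
      destruct p' as [n|]; [|cbn in Hlt; lia].
      specialize (Hf n). destruct (a i (Fin n)) as [m|]; [|contradiction].
      pose proof (compress_fin_lt Q K m HK). lia.
  - apply enc_meet in He as (s1 & s2 & -> & <- & <-). apply HL in Hin. cbn [evalT] in Hf.
    destruct (flag_exists (evalT a s1)) as (u & Hu & F1), (flag_exists (evalT a s2)) as (v & Hv & F2).
    exists u; split; [lia|]. exists v; split; [lia|].
    split; [|split]; [apply table_flag; [apply Hin; cbn|]; auto ..|].
    unfold flag in *. rewrite finitary_meet in Hf by now apply time_warp_eval.
    destruct F1 as [[-> ?]|[-> ?]], F2 as [[-> ?]|[-> ?]], Hf as [[-> ?]|[-> ?]]; cbn; tauto.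
  - apply enc_join in He as (s1 & s2 & -> & <- & <-). apply HL in Hin. cbn [evalT] in Hf.
    destruct (flag_exists (evalT a s1)) as (u & Hu & F1), (flag_exists (evalT a s2)) as (v & Hv & F2).
    exists u; split; [lia|]. exists v; split; [lia|].
    split; [|split]; [apply table_flag; [apply Hin; cbn|]; auto ..|].
    unfold flag in *. rewrite finitary_join in Hf.
    destruct F1 as [[-> ?]|[-> ?]], F2 as [[-> ?]|[-> ?]], Hf as [[-> ?]|[-> ?]]; cbn; tauto.
  - apply enc_mul in He as (f & g & -> & <- & <-). apply HL in Hin. cbn [evalT] in Hf.
    assert (Hin1 : In (g, Some Om) L) by (apply Hin; cbn; auto).
    assert (Hin2 : In (f, Some (evalT a g Om)) L) by (apply Hin; cbn; auto).
    assert (Hin3 : In (g, None) L) by (apply Hin; cbn; auto).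
    assert (Hin4 : In (f, None) L) by (apply Hin; cbn; auto).
    assert (Htf : time_warp (evalT a f)) by now apply time_warp_eval.
    assert (Htg : time_warp (evalT a g)) by now apply time_warp_eval.
    assert (HTg := table_value a L Q K g Om Hin1). cbn [compress] in HTg.
    destruct (classic (finitary (evalT a g) /\ evalT a g Om = Om)) as [[Fg E]|Hn].
    + left. rewrite E in HTg. cbn [compress] in HTg.
      split; [apply table_flag; [|right]; auto|]. split; [assumption|].
      apply table_flag; [assumption|]. unfold flag in *.
      rewrite finitary_comp_unbounded in Hf; auto.
    + right. exists (compress Q K (evalT a g Om)); split; auto.
      exists (compress Q K (evalT a f (evalT a g Om))); split; auto.
      split; [assumption|]. split; [|split; [now apply table_value|]].
      * destruct (classic (evalT a g Om = Om)) as [E|E].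
        -- right. apply table_flag; [assumption|]. left; split; [reflexivity|]. tauto.
        -- left. rewrite <- (compress_om_iff Q K _ HK) in E. lia.
      * unfold flag in Hf. rewrite finitary_comp_attained in Hf; auto; [|tauto].
        rewrite <- (compress_om_iff Q K _ HK) in Hf. lia.
  - apply enc_star in He as (s' & -> & <-). apply HL in Hin. cbn [evalT] in Hf.
    exists (compress Q K (evalT a s' Om)); split; auto. split.
    + apply (table_value a L Q K s' Om). apply Hin; now left.
    + unfold flag in Hf. rewrite finitary_star in Hf by now apply time_warp_eval.
      rewrite <- (compress_om_iff Q K _ HK) in Hf. lia.
  - apply enc_one in He as ->. destruct Hf as [[_ Hf]|[-> _]]; [|reflexivity].
    destruct Hf. intros n; discriminate.
Qed.

Definition support (a : nat -> omp -> omp) (L : list (term * option omp)) : list nat :=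
  let fins p := match p with Fin n => [n] | Om => [] end in
  0 :: flat_map (fun '(s, q) =>
         match q with Some p => fins p ++ fins (evalT a s p) | None => [] end) L.

Lemma support_covers a L : covers a (support a L) L.
Proof.
  assert (H : forall s p n, In (s, Some p) L -> p = Fin n \/ evalT a s p = Fin n ->
            In n (support a L)).
  { intros s p n Hin E. right. apply in_flat_map. exists (s, Some p). split; [assumption|].
    apply in_or_app. destruct E as [E|E]; rewrite E; cbn; auto. }
  intros s p Hin; split; [destruct p | destruct (evalT a s p) eqn:E]; cbn [covered]; eauto.
Qed.

Lemma support_length a L : length (support a L) <= 1 + 2 * length L.
Proof.
  cbn -[Nat.mul]. apply le_n_S. induction L as [|[s q] L IH]; [cbn; lia|].
  cbn [flat_map]. rewrite length_app. cbn [length].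
  destruct q as [p|]; [rewrite length_app; destruct p, (evalT a s _)|]; cbn [length]; lia.
Qed.

(** This is 16 * 4^N: the two sample lists have at most 4 * 4^N entries, their support at most 1 + 8
    * 4^N, and compression needs 2 more. It is written as a power of 2 to match [Pow2]. *)
Definition size_bound (N : nat) : nat := 2 ^ (N + N + 4).

Lemma size_bound_eq N : size_bound N = 16 * 4 ^ N.
Proof.
  unfold size_bound. rewrite !Nat.pow_add_r.
  replace (4 ^ N) with (2 ^ N * 2 ^ N) by (rewrite <- Nat.pow_mul_l; reflexivity).
  change (2 ^ 4) with 16. lia.
Qed.

(** The bounds on the entries are what allows the relation to be coded by a single number
    afterwards. *)
Lemma counterexample_table s t :
  ~ W_models s t ->
  let K := size_bound (enc s + enc t) in
  exists R, consistent R K (enc s + enc t) /\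
    (forall e x y, R e x y -> e <= enc s + enc t /\ x <= 1 + K /\ y <= K) /\
    exists x, x <= K /\ exists y, y <= K /\ exists z, z <= K /\
      (y <> z /\ R (enc s) x y /\ R (enc t) x z).
Proof.
  intros HW K.
  apply not_all_ex_not in HW as [a HW]. apply imply_to_and in HW as [Ha HW].
  apply not_all_ex_not in HW as [p Hp].
  set (L := samples a s (Some p) ++ samples a t (Some p)).
  set (Q := support a L).
  assert (HK : 2 + length Q <= K).
  { unfold K, Q. rewrite size_bound_eq. pose proof (support_length a L).
    unfold L in *. rewrite length_app in *.
    pose proof (samples_length a s (Some p)). pose proof (samples_length a t (Some p)).
    pose proof (Nat.pow_le_mono_r 4 (enc s) (enc s + enc t)).
    pose proof (Nat.pow_le_mono_r 4 (enc t) (enc s + enc t)).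
    pose proof (Nat.pow_nonzero 4 (enc s + enc t)). lia. }
  assert (HL : closed a L) by (apply closed_app; apply samples_closed).
  assert (HQ : covers a Q L) by apply support_covers.
  assert (Hs : In (s, Some p) L) by (apply in_or_app; left; apply samples_self).
  assert (Ht : In (t, Some p) L) by (apply in_or_app; right; apply samples_self).
  exists (table a L Q K). split; [|split].
  - intros i _ j _ x Hx y _; split.
    + apply table_value_ok; auto. now left.
    + now apply table_flag_ok.
  - intros e x y (s' & q & Hin & <- & H). split.
    + apply in_app_or in Hin as [Hin|Hin]; apply samples_enc in Hin; lia.
    + destruct q as [p'|].
      * destruct H as [-> ->]. pose proof (compress_le_bound Q K p' HK).
        pose proof (compress_le_bound Q K (evalT a s' p') HK). lia.
      * destruct H as [-> H%flag_le]. lia.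
  - exists (compress Q K p); split; [now apply compress_le_bound|].
    exists (compress Q K (evalT a s p)); split; [now apply compress_le_bound|].
    exists (compress Q K (evalT a t p)); split; [now apply compress_le_bound|].
    split; [|split; now apply table_value]. intros E. apply Hp.
    apply leo_antisym; apply (compress_reflect Q K); auto; try lia;
      [apply (HQ t) | apply (HQ s)]; assumption.
Qed.

(** * The decision procedure *)

(** Induction splits off the lowest digit, decided by excluded middle, so [P] may be any
    predicate. *)
Lemma bitset_exists n (P : nat -> Prop) :
  exists T, T < 2 ^ n /\ forall i, Nat.testbit T i = true <-> i < n /\ P i.
Proof.
  revert P; induction n as [|n IH]; intros P.
  - exists 0; split; [cbn; lia|]. intros i. rewrite Nat.bits_0. split; [discriminate | lia].
  - destruct (IH (fun i => P (S i))) as (T & HT & H).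
    assert (HS : 2 ^ S n = 2 * 2 ^ n) by reflexivity.
    destruct (classic (P 0)) as [HP|HP].
    + exists (2 * T + 1); split; [lia|]. intros [|i].
      * rewrite Nat.testbit_odd_0. split; [auto with arith | auto].
      * rewrite Nat.testbit_odd_succ by lia. rewrite H. split; intros []; split; auto; lia.
    + exists (2 * T); split; [lia|]. intros [|i].
      * rewrite Nat.testbit_even_0. split; [discriminate | tauto].
      * rewrite Nat.testbit_even_succ by lia. rewrite H. split; intros []; split; auto; lia.
Qed.

Definition bit_table (T e x y : nat) : Prop := Nat.testbit T (cpair e (cpair x y)) = true.

(** The exponent exceeds every relevant digit index: codes go up to N, arguments up to 1 + K because
    of flags, values up to K, and [cpair] is monotone. *)
Definition refutable (m n : nat) : Prop :=
  let N := m + n in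
  let K := size_bound N in
  exists T, T <= 2 ^ (1 + cpair N (cpair (1 + K) K)) /\
    (consistent (bit_table T) K N /\
     exists x, x <= K /\ exists y, y <= K /\ exists z, z <= K /\
       (y <> z /\ bit_table T m x y /\ bit_table T n x z)).

Lemma refutable_iff s t : refutable (enc s) (enc t) <-> ~ W_models s t.
Proof.
  split.
  - intros (T & _ & HT & x & Hx & y & Hy & z & Hz & Hne & H1 & H2).
    refine (table_refutes _ _ _ s t x y z _ HT _ _ Hx Hy Hz Hne H1 H2); try lia.
    rewrite size_bound_eq. pose proof (Nat.pow_nonzero 4 (enc s + enc t)). lia.
  - intros (R & HR & Hb & Hx)%counterexample_table. unfold refutable.
    set (N := enc s + enc t) in *. set (K := size_bound N) in *.
    destruct (bitset_exists (1 + cpair N (cpair (1 + K) K))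
      (fun i => exists e x y, i = cpair e (cpair x y) /\ R e x y)) as (T & HT & H).
    assert (bit_table T = R) as E.
    { extensionality e; extensionality x; extensionality y.
      apply propositional_extensionality. unfold bit_table. rewrite H. split.
      - intros (_ & e' & x' & y' & [-> [-> ->]%cpair_inj]%cpair_inj & HR'). assumption.
      - intros HR'. destruct (Hb _ _ _ HR') as (? & ? & ?). split; [|eauto].
        cbn [Nat.add]. apply le_n_S. apply cpair_mono; [assumption|].
        now apply cpair_mono. }
    exists T; split; [lia|]. now rewrite E.
Qed.

(** Levels 0 and 1 hold the two codes and 2 the table. In the local conditions 3 to 6 are [a], [b],
    [x], [y], and 7 and 8 the inner variables; in the last conjunct 3 to 5 are the argument and the
    two values. *)
Definition refutable_fm : fm :=
  let N := Add (V 0) (V 1) in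
  let K := Pow2 (Add (Add N N) (C 4)) in
  let R e x y := Bit (V 2) (Pair e (Pair x y)) in
  let a := V 3 in
  let b := V 4 in
  let x := V 5 in
  let y := V 6 in
  let u := V 7 in
  let v := V 8 in
  let suc := Add (C 1) in
  let min := Sub u (Sub u v) in
  let max := Add u (Sub v u) in
  let exi2 f := Exi K (Exi K f) in
  let var := Pair (C 0) a in
  let meet := Pair (C 1) (Pair a b) in
  let join := Pair (C 2) (Pair a b) in
  let mul := Pair (C 3) (Pair a b) in
  let star := Pair (C 4) a in
  let one := Pair (C 5) (C 0) in
  let value :=
    And (Imp (R var x y)
          (And (Imp (Le x (C 0)) (Le y (C 0)))
               (All K (All K (Imp (R var u v) (Imp (Le x u) (Le y v)))))))
   (And (Imp (R meet x y) (exi2 (And (R a x u) (And (R b x v) (Eq y min)))))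
   (And (Imp (R join x y) (exi2 (And (R a x u) (And (R b x v) (Eq y max)))))
   (And (Imp (R mul x y) (Exi K (And (R b x u) (R a u y))))
   (And (Imp (R star x y)
          (Or (And (Le x (C 0)) (Le y (C 0)))
          (Or (And (Le (C 1) x) (And (Le (Add (C 2) y) K)
                (exi2 (And (R a y u) (And (R a (suc y) v) (And (Le (suc u) x) (Le x v)))))))
          (Or (And (Le (suc x) K) (And (Eq y K) (Exi K (And (R a K u) (Le (suc u) x)))))
              (And (Eq x K) (And (Eq y K) (R a (suc K) (C 1))))))))
        (Imp (R one x y) (Eq y x)))))) in
  let flag :=
    And (Imp (R var (suc K) y)
          (Or (And (Eq y (C 0)) (Exi K (And (Le (suc u) K) (R var u K))))
              (And (Eq y (C 1))
                   (All K (All K (Imp (Le (suc u) K) (Imp (R var u v) (Le (suc v) K))))))))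
   (And (Imp (R meet (suc K) y)
          (exi2 (And (R a (suc K) u) (And (R b (suc K) v) (Eq y max)))))
   (And (Imp (R join (suc K) y)
          (exi2 (And (R a (suc K) u) (And (R b (suc K) v) (Eq y min)))))
   (And (Imp (R mul (suc K) y)
          (Or (And (R b (suc K) (C 1)) (And (R b K K) (R a (suc K) y)))
              (exi2
                (And (R b K u) (And (Or (Le (suc u) K) (R b (suc K) (C 0))) (And (R a u v)
                  (Or (And (Eq y (C 0)) (Le K v)) (And (Eq y (C 1)) (Le (suc v) K)))))))))
   (And (Imp (R star (suc K) y)
          (Exi K (And (R a K u)
            (Or (And (Eq y (C 0)) (Le (suc u) K)) (And (Eq y (C 1)) (Le K u))))))
        (Imp (R one (suc K) y) (Eq y (C 1))))))) in
  Exi (Pow2 (suc (Pair N (Pair (suc K) K))))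
    (And (All N (All N (All K (All K (And value flag)))))
         (Exi K (Exi K (Exi K
           (And (Not (Eq (V 4) (V 5)))
                (And (R (V 0) (V 3) (V 4)) (R (V 1) (V 3) (V 5)))))))).

(** Holds by computation: the local conditions are phrased with bounded quantifiers and forms such
    as [1 + u <= x] so that the formula unfolds to the same proposition. *)
Lemma sat_refutable_fm m n : sat [m; n] refutable_fm = refutable m n.
Proof. reflexivity. Qed.

Theorem theorem3p12 :
  exists c : prf, forall s t : term,
    (W_models s t -> evalp c [enc s; enc t] 1) /\
    (~ W_models s t -> evalp c [enc s; enc t] 0).
Proof.
  (* Compiling the negation makes output 1 mean that no table refutes the equation. *)
  exists (code_fm 2 (Not refutable_fm)). intros s t.
  apply (decides_iff _ _ (~ refutable (enc s) (enc t))).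
  - rewrite refutable_iff. split; [apply NNPP | auto].
  - rewrite <- sat_refutable_fm. exact (code_fm_correct (Not refutable_fm) [enc s; enc t]).
Qed.
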